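(* Let $R$ be an associative ring with identity, let $Q$ be a locally target-finite quiver and let $X$ be a representation in $\mathrm{Rep}(Q,R)$. If $X$ is strongly fp-injective, then for each vertex $i\in Q_0$ the $R$-module $X(i)$ is strongly fp-injective and the canonical homomorphism $\psi_i^X: X(i)\to\prod_{a\in Q_1,\, s(a)=i}X(t(a))$ is a pure epimorphism. The converse also holds provided that $Q$ is right rooted.
   Context: Modules are left $R$-modules; right $R$-modules are called $R^{\mathrm{op}}$-modules. A quiver $Q=(Q_0,Q_1)$ is a directed graph with vertex set $Q_0$ and arrow set $Q_1$; an arrow $a$ has source $s(a)$ and target $t(a)$. $\mathrm{Rep}(Q,R)$ is the abelian category of representations of $Q$ by $R$-modules, i.e. covariant functors from the (path category of the) quiver $Q$ to $R$-modules, with natural transformations as morphisms. $Q^{\mathrm{op}}$ is the quiver with the same vertices and all arrows reversed. $Q$ is locally target-finite if for every vertex $v$ the set of arrows with source $v$ is finite. $Q$ is right rooted if there is no infinite sequence of arrows $\bullet\to\bullet\to\bullet\to\cdots$ in $Q$. The map $\psi_i^X$ is the unique homomorphism whose component at an arrow $a$ with $s(a)=i$ is $X(a):X(i)\to X(t(a))$. Tensor product: for $X\in\mathrm{Rep}(Q,R)$ and an abelian group $G$, let $\mathrm{Hom}(X,G)\in\mathrm{Rep}(Q^{\mathrm{op}},R^{\mathrm{op}})$ be the representation with $\mathrm{Hom}(X,G)(i)=\mathrm{Hom}_{\mathbb Z}(X(i),G)$ and the induced maps on reversed arrows. The functor $\mathrm{Hom}(X,-):\mathbb{Z}\text{-Mod}\to\mathrm{Rep}(Q^{\mathrm{op}},R^{\mathrm{op}})$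 has a left adjoint, denoted $-\otimes_Q X$. Purity: a short exact sequence $\eta$ in $\mathrm{Rep}(Q,R)$ is pure if $S\otimes_Q\eta$ is exact for every $S\in\mathrm{Rep}(Q^{\mathrm{op}},R^{\mathrm{op}})$. A long exact sequence is pure if all the short exact sequences into which it decomposes are pure. A representation $X$ is strongly fp-injective if there is a pure exact sequence $0\to X\to E^0\to E^1\to\cdots$ in $\mathrm{Rep}(Q,R)$ with every $E^i$ injective in $\mathrm{Rep}(Q,R)$. For modules: a short exact sequence of $R$-modules is pure if it stays exact after applying $M\otimes_R-$ for every $R^{\mathrm{op}}$-module $M$; a pure epimorphism is an epimorphism $g:Y\to Z$ for which $0\to\ker g\to Y\to Z\to 0$ is pure. An $R$-module $L$ is strongly fp-injective if $\mathrm{Ext}^n_R(P,L)=0$ for every finitely presented $R$-module $P$ and all $n\ge 1$. *)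

(* Defs.v *)
From HB Require Import structures.
From mathcomp Require Import all_boot all_order all_algebra generic_quotient.
From mathcomp Require Import finmap boolp classical_sets functions cardinality fsbigop.

Set Implicit Arguments.
Unset Strict Implicit.
Unset Printing Implicit Defensive.

Import GRing.Theory.
Local Open Scope ring_scope.
Local Open Scope quotient_scope.

(* Rings are [pzRingType]s, so the zero ring is allowed.  Left R-modules are   *)
(* [lmodType R], right R-modules are [lmodType R^c].                           *)

Section Kernel.
Variables (R : pzRingType) (U V : lmodType R) (f : {linear U -> V}).

Definition in_ker : pred U := fun x => f x == 0.

Lemma in_ker_submod_closed : submod_closed in_ker.
Proof.
split=> [|a x y]; rewrite /in_ker !unfold_in ?linear0 // => /eqP fx /eqP fy.
by rewrite linearP fx fy scaler0 addr0.
Qed.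
HB.instance Definition _ :=
  GRing.isSubmodClosed.Build R U in_ker in_ker_submod_closed.

Record ker := Ker { ker_val :> U; _ : ker_val \in in_ker }.
HB.instance Definition _ := [isSub for ker_val].
HB.instance Definition _ := [Choice of ker by <:].
HB.instance Definition _ := [SubChoice_isSubLmodule of ker by <:].

Definition ker_incl : {linear ker -> U} := val.

Lemma kerP (x : ker) : f (ker_val x) = 0.
Proof. by case: x => x /= /eqP. Qed.

End Kernel.

Section KernelLift.
Variables (R : pzRingType) (U V W : lmodType R).
Variables (f : {linear U -> V}) (g : {linear V -> W}).
Hypothesis gf0 : forall x, g (f x) = 0.

Definition ker_lift_fun (x : U) : ker g := @Ker _ _ _ g (f x) (introT eqP (gf0 x)).

Lemma ker_lift_is_linear : linear ker_lift_fun.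
Proof. by move=> a x y; apply: val_inj; rewrite /= !linearP. Qed.
HB.instance Definition _ :=
  GRing.isLinear.Build R U (ker g) *:%R ker_lift_fun ker_lift_is_linear.

Definition ker_lift : {linear U -> ker g} := ker_lift_fun.

End KernelLift.

Section DependentProduct.
Variables (R : pzRingType) (I : Type) (V : I -> lmodType R).

Definition dprod := forall i, V i.
Implicit Types f g h : dprod.

HB.instance Definition _ := gen_eqMixin dprod.
HB.instance Definition _ := gen_choiceMixin dprod.

Definition dprod_zero : dprod := fun i => 0.
Definition dprod_opp f : dprod := fun i => - f i.
Definition dprod_add f g : dprod := fun i => f i + g i.
Definition dprod_scale (r : R) f : dprod := fun i => r *: f i.

Lemma dprod_addA : associative dprod_add.
Proof. by move=> f g h; apply: functional_extensionality_dep => i; apply: addrA. Qed.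
Lemma dprod_addC : commutative dprod_add.
Proof. by move=> f g; apply: functional_extensionality_dep => i; apply: addrC. Qed.
Lemma dprod_add0 : left_id dprod_zero dprod_add.
Proof. by move=> f; apply: functional_extensionality_dep => i; apply: add0r. Qed.
Lemma dprod_addN : left_inverse dprod_zero dprod_opp dprod_add.
Proof. by move=> f; apply: functional_extensionality_dep => i; apply: addNr. Qed.
HB.instance Definition _ :=
  GRing.isZmodule.Build dprod dprod_addA dprod_addC dprod_add0 dprod_addN.

Lemma dprod_scaleA a b f :
  dprod_scale a (dprod_scale b f) = dprod_scale (a * b) f.
Proof. by apply: functional_extensionality_dep => i; apply: scalerA. Qed.
Lemma dprod_scale1 : left_id 1 dprod_scale.
Proof. by move=> f; apply: functional_extensionality_dep => i; apply: scale1r. Qed.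
Lemma dprod_scaleDr : right_distributive dprod_scale +%R.
Proof. by move=> a f g; apply: functional_extensionality_dep => i; apply: scalerDr. Qed.
Lemma dprod_scaleDl f : {morph dprod_scale^~ f : a b / a + b}.
Proof. by move=> a b; apply: functional_extensionality_dep => i; apply: scalerDl. Qed.
HB.instance Definition _ := GRing.Zmodule_isLmodule.Build R dprod
  dprod_scaleA dprod_scale1 dprod_scaleDr dprod_scaleDl.

End DependentProduct.

(* [homZ N G] is the group Hom_Z(N, G); for an R-module N it is the right      *)
(* R-module with (f r) x = f (r x).                                            *)
Definition homZ (N G : zmodType) := {additive N -> G}.

Section HomZ.
Variables N G : zmodType.
Implicit Types f g h : homZ N G.

HB.instance Definition _ := gen_eqMixin (homZ N G).
HB.instance Definition _ := gen_choiceMixin (homZ N G).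

Lemma homZ_ext f g : (forall x, f x = g x) -> f = g.
Proof.
case: f g => f [[Hf]] [g [[Hg]]] /= /funext E; move: Hf Hg; rewrite {}E => Hf Hg.
by rewrite (Prop_irrelevance Hf Hg).
Qed.

Definition homZ_zero : homZ N G := (\0 : {additive N -> G}).
Definition homZ_opp f : homZ N G := (\- f : {additive N -> G}).
Definition homZ_add f g : homZ N G := (f \+ g : {additive N -> G}).

Lemma homZ_addA : associative homZ_add.
Proof. by move=> f g h; apply: homZ_ext => x; apply: addrA. Qed.
Lemma homZ_addC : commutative homZ_add.
Proof. by move=> f g; apply: homZ_ext => x; apply: addrC. Qed.
Lemma homZ_add0 : left_id homZ_zero homZ_add.
Proof. by move=> f; apply: homZ_ext => x; apply: add0r. Qed.
Lemma homZ_addN : left_inverse homZ_zero homZ_opp homZ_add.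
Proof. by move=> f; apply: homZ_ext => x; apply: addNr. Qed.
HB.instance Definition _ :=
  GRing.isZmodule.Build (homZ N G) homZ_addA homZ_addC homZ_add0 homZ_addN.

End HomZ.

Section HomZRightModule.
Variables (R : pzRingType) (N : lmodType R) (G : zmodType).
Implicit Types f g : homZ N G.

Definition homZ_scale_fun (r : R^c) f : N -> G := fun x => f ((r : R) *: x).

Lemma homZ_scale_fun_is_zmod_morphism r f : zmod_morphism (homZ_scale_fun r f).
Proof. by move=> x y; rewrite /homZ_scale_fun scalerBr raddfB. Qed.
HB.instance Definition _ r f := GRing.isZmodMorphism.Build N G
  (homZ_scale_fun r f) (homZ_scale_fun_is_zmod_morphism r f).

Definition homZ_scale (r : R^c) f : homZ N G :=
  (homZ_scale_fun r f : {additive N -> G}).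

Lemma homZ_scaleA a b f : homZ_scale a (homZ_scale b f) = homZ_scale (a * b) f.
Proof.
by apply: homZ_ext => x; rewrite /= /homZ_scale_fun /= /homZ_scale_fun scalerA.
Qed.
Lemma homZ_scale1 : left_id 1 homZ_scale.
Proof. by move=> f; apply: homZ_ext => x; rewrite /= /homZ_scale_fun scale1r. Qed.
Lemma homZ_scaleDr : right_distributive homZ_scale +%R.
Proof. by move=> a f g; apply: homZ_ext. Qed.
Lemma homZ_scaleDl f : {morph homZ_scale^~ f : a b / a + b}.
Proof.
by move=> a b; apply: homZ_ext => x; rewrite /= /homZ_scale_fun scalerDl raddfD.
Qed.
HB.instance Definition _ := GRing.Zmodule_isLmodule.Build R^c (homZ N G)
  homZ_scaleA homZ_scale1 homZ_scaleDr homZ_scaleDl.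

End HomZRightModule.

Section HomZFunctor.
Variables (R : pzRingType) (N N' : lmodType R) (G : zmodType).
Variable f : {linear N -> N'}.

Definition homZ_pre_fun (h : homZ N' G) : homZ N G := (h \o f : {additive N -> G}).

Lemma homZ_pre_is_linear :
  linear (homZ_pre_fun : homZ N' G -> homZ N G).
Proof.
by move=> a g h; apply: homZ_ext => x; rewrite /= /homZ_scale_fun /= linearZ.
Qed.
HB.instance Definition _ := GRing.isLinear.Build R^c (homZ N' G) (homZ N G) *:%R
  homZ_pre_fun homZ_pre_is_linear.

Definition homZ_pre : {linear homZ N' G -> homZ N G} := homZ_pre_fun.

End HomZFunctor.

Record quiver := Quiver { vertex :> Type; arrow : vertex -> vertex -> Type }.

Definition op_quiver (Q : quiver) := @Quiver Q (fun i j => arrow j i).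

(* The arrows with source i, each tagged by its target. *)
Definition out_arrow (Q : quiver) (i : Q) := {j : Q & arrow i j}.

Definition locally_target_finite (Q : quiver) :=
  forall i : Q, finite_set [set: out_arrow i].

Definition right_rooted (Q : quiver) :=
  forall v : nat -> Q, (forall n, arrow (v n) (v n.+1)) -> False.

(* A functor out of the free category on Q is determined by, and can be        *)
(* prescribed freely on, vertices and arrows.                                  *)
Record rep (Q : quiver) (R : pzRingType) := Rep {
  rep_obj :> Q -> lmodType R;
  rep_map : forall i j, arrow i j -> {linear rep_obj i -> rep_obj j} }.
Arguments rep_map {Q R} X {i j} a : rename.

Record rep_hom (Q : quiver) (R : pzRingType) (X Y : rep Q R) := RepHom {
  rep_hom_at :> forall i, {linear X i -> Y i};
  rep_hom_nat : forall i j (a : arrow i j) (x : X i),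
    rep_hom_at j (rep_map X a x) = rep_map Y a (rep_hom_at i x) }.

Section RepConstructions.
Variables (Q : quiver) (R : pzRingType).
Implicit Types X Y Z : rep Q R.

Lemma ker_rep_map_subproof X Y (f : rep_hom X Y) i j (a : arrow i j) x :
  f j ((rep_map X a \o ker_incl (f i)) x) = 0.
Proof. by rewrite /= rep_hom_nat kerP linear0. Qed.

Definition ker_rep_map X Y (f : rep_hom X Y) i j (a : arrow i j) :
    {linear ker (f i) -> ker (f j)} :=
  ker_lift (@ker_rep_map_subproof X Y f i j a).

Definition ker_rep X Y (f : rep_hom X Y) : rep Q R :=
  @Rep Q R (fun i => ker (f i)) (ker_rep_map f).

Lemma ker_rep_incl_nat X Y (f : rep_hom X Y) i j (a : arrow i j) x :
  ker_incl (f j) (rep_map (ker_rep f) a x) = rep_map X a (ker_incl (f i) x).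
Proof. by []. Qed.

Definition ker_rep_incl X Y (f : rep_hom X Y) : rep_hom (ker_rep f) X :=
  RepHom (@ker_rep_incl_nat X Y f).

Lemma ker_rep_lift_nat X Y Z (f : rep_hom X Y) (g : rep_hom Y Z)
    (gf0 : forall i x, g i (f i x) = 0) i j (a : arrow i j) x :
  ker_lift (gf0 j) (rep_map X a x) = rep_map (ker_rep g) a (ker_lift (gf0 i) x).
Proof. by apply: val_inj; rewrite /= /ker_lift_fun /= rep_hom_nat. Qed.

Definition ker_rep_lift X Y Z (f : rep_hom X Y) (g : rep_hom Y Z)
    (gf0 : forall i x, g i (f i x) = 0) : rep_hom X (ker_rep g) :=
  @RepHom Q R X (ker_rep g) (fun i => ker_lift (gf0 i)) (ker_rep_lift_nat gf0).

Definition hom_rep X (G : zmodType) : rep (op_quiver Q) R^c :=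
  @Rep (op_quiver Q) R^c (fun i => homZ (X i) G)
    (fun i j (a : @arrow (op_quiver Q) i j) => homZ_pre G (@rep_map Q R X j i a)).

End RepConstructions.

(* Formal Z-linear combinations of elements of T, two of them identified when  *)
(* every admissible map to an abelian group gives them the same value.         *)
Section FormalSums.
Variables (T : Type) (adm : forall G : zmodType, (T -> G) -> Prop).

Definition word := {classic seq (int * T)}.

Definition eval (G : zmodType) (b : T -> G) (w : word) : G :=
  \sum_(p <- w) b p.2 *~ p.1.

Definition word_eq (w1 w2 : word) : bool :=
  `[< forall (G : zmodType) (b : T -> G), adm b -> eval b w1 = eval b w2 >].

Lemma word_eqP w1 w2 : reflect
  (forall (G : zmodType) (b : T -> G), adm b -> eval b w1 = eval b w2)
  (word_eq w1 w2).
Proof. exact: asboolP. Qed.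

Lemma word_eq_refl : reflexive word_eq.
Proof. by move=> w; apply/word_eqP. Qed.
Lemma word_eq_sym : symmetric word_eq.
Proof. by move=> w1 w2; apply/word_eqP/word_eqP => H G b Hb; rewrite H. Qed.
Lemma word_eq_trans : transitive word_eq.
Proof.
move=> w2 w1 w3 /word_eqP H1 /word_eqP H2.
by apply/word_eqP => G b Hb; rewrite H1 ?H2.
Qed.
Canonical word_equiv := EquivRel word_eq word_eq_refl word_eq_sym word_eq_trans.

Definition fsum := {eq_quot word_eq}.

Definition fs_eval (G : zmodType) (b : T -> G) (u : fsum) : G := eval b (repr u).

Lemma fs_eval_pi (G : zmodType) (b : T -> G) w :
  adm b -> fs_eval b (\pi_fsum w) = eval b w.
Proof.
move=> Hb; have /eqmodP/word_eqP H := reprK (\pi_fsum w).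
exact: H.
Qed.

Lemma fs_ext (u v : fsum) :
  (forall (G : zmodType) (b : T -> G), adm b -> fs_eval b u = fs_eval b v) ->
  u = v.
Proof.
move=> H; rewrite -[u]reprK -[v]reprK; apply/eqmodP/word_eqP => G b Hb.
exact: H.
Qed.

Definition fs_zero : fsum := \pi_fsum ([::] : word).
Definition fs_opp (u : fsum) : fsum :=
  \pi_fsum ([seq (- p.1, p.2) | p <- repr u] : word).
Definition fs_add (u v : fsum) : fsum := \pi_fsum (repr u ++ repr v : word).

Section Eval.
Variables (G : zmodType) (b : T -> G).
Hypothesis Hb : adm b.

Lemma fs_eval0 : fs_eval b fs_zero = 0.
Proof. by rewrite fs_eval_pi // /eval big_nil. Qed.
Lemma fs_evalN u : fs_eval b (fs_opp u) = - fs_eval b u.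
Proof.
rewrite fs_eval_pi // /eval big_map -sumrN.
by apply: eq_bigr => p _; rewrite mulrNz.
Qed.
Lemma fs_evalD u v : fs_eval b (fs_add u v) = fs_eval b u + fs_eval b v.
Proof. by rewrite fs_eval_pi // /eval big_cat. Qed.
End Eval.

Lemma fs_addA : associative fs_add.
Proof. by move=> u v w; apply: fs_ext => G b Hb; rewrite !fs_evalD // addrA. Qed.
Lemma fs_addC : commutative fs_add.
Proof. by move=> u v; apply: fs_ext => G b Hb; rewrite !fs_evalD // addrC. Qed.
Lemma fs_add0 : left_id fs_zero fs_add.
Proof. by move=> u; apply: fs_ext => G b Hb; rewrite fs_evalD // fs_eval0 // add0r. Qed.
Lemma fs_addN : left_inverse fs_zero fs_opp fs_add.
Proof.
by move=> u; apply: fs_ext => G b Hb; rewrite fs_evalD // fs_evalN // fs_eval0 // addNr.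
Qed.
HB.instance Definition _ := Choice.on fsum.
HB.instance Definition _ :=
  GRing.isZmodule.Build fsum fs_addA fs_addC fs_add0 fs_addN.

Definition fs_gen (t : T) : fsum := \pi_fsum ([:: (1, t)] : word).

Lemma fs_eval_gen (G : zmodType) (b : T -> G) t : adm b -> fs_eval b (fs_gen t) = b t.
Proof. by move=> Hb; rewrite fs_eval_pi // /eval big_seq1 mulr1z. Qed.

Section Lift.
Variables (G : zmodType) (b : T -> G).
Hypothesis Hb : adm b.

Definition fs_lift_fun (_ : adm b) := fs_eval b.
Lemma fs_lift_is_zmod_morphism : zmod_morphism (fs_lift_fun Hb).
Proof. by move=> u v; rewrite /fs_lift_fun fs_evalD // fs_evalN. Qed.
HB.instance Definition _ := GRing.isZmodMorphism.Build fsum G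
  (fs_lift_fun Hb) fs_lift_is_zmod_morphism.
Definition fs_lift : {additive fsum -> G} := fs_lift_fun Hb.

Lemma fs_lift_gen t : fs_lift (fs_gen t) = b t.
Proof. exact: fs_eval_gen. Qed.
End Lift.

Lemma fs_sum (u : fsum) : u = \sum_(p <- repr u) fs_gen p.2 *~ p.1.
Proof.
apply: fs_ext => G b Hb; rewrite -[RHS]/(fs_lift Hb _) raddf_sum /=.
by apply: eq_bigr => p _; rewrite -[fs_lift_fun Hb]/(fs_lift Hb : _ -> _) raddfMz fs_lift_gen.
Qed.

Lemma fs_hom_ext (G : zmodType) (h k : {additive fsum -> G}) :
  (forall t, h (fs_gen t) = k (fs_gen t)) -> forall u, h u = k u.
Proof.
move=> H u; rewrite [u]fs_sum !raddf_sum; apply: eq_bigr => p _.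
by rewrite !raddfMz H.
Qed.

End FormalSums.

Section ModuleTensor.
Variables (R : pzRingType) (M : lmodType R^c).
Implicit Types N : lmodType R.

(* Balanced maps on M * N, presented as right R-linear M -> Hom_Z(N, G). *)
Definition mod_balanced N (G : zmodType) (b : M * N -> G) : Prop :=
  exists f : {linear M -> homZ N G}, forall p, b p = f p.1 p.2.

Definition mod_tensor N : zmodType := fsum (@mod_balanced N).
Definition mod_tens N (m : M) (x : N) : mod_tensor N :=
  fs_gen (@mod_balanced N) (m, x).

Lemma mod_tensDl N m m' (x : N) :
  mod_tens (m + m') x = mod_tens m x + mod_tens m' x.
Proof.
apply: fs_ext => G b Hb; case: (Hb) => f E.
by rewrite [RHS]fs_evalD // !fs_eval_gen // !E /= raddfD.
Qed.
Lemma mod_tensDr N m (x x' : N) :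
  mod_tens m (x + x') = mod_tens m x + mod_tens m x'.
Proof.
apply: fs_ext => G b Hb; case: (Hb) => f E.
by rewrite [RHS]fs_evalD // !fs_eval_gen // !E /= raddfD.
Qed.
Lemma mod_tensZ N (r : R) m (x : N) :
  mod_tens ((r : R^c) *: m) x = mod_tens m (r *: x).
Proof.
apply: fs_ext => G b Hb; case: (Hb) => f E.
by rewrite !fs_eval_gen // !E /= linearZ.
Qed.

Section Unit.
Variable N : lmodType R.

Section At.
Variable m : M.
Lemma mod_tens_is_zmod_morphism : zmod_morphism (@mod_tens N m).
Proof.
have tens0 : mod_tens m (0 : N) = 0.
  by apply: (addrI (mod_tens m 0)); rewrite -mod_tensDr !addr0.
move=> x y; rewrite mod_tensDr; congr (_ + _); apply: (addrI (mod_tens m y)).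
by rewrite -mod_tensDr !subrr.
Qed.
HB.instance Definition _ := GRing.isZmodMorphism.Build N (mod_tensor N)
  (@mod_tens N m) mod_tens_is_zmod_morphism.
End At.

Definition mod_unit_fun (m : M) : homZ N (mod_tensor N) :=
  (@mod_tens N m : {additive N -> mod_tensor N}).
Lemma mod_unit_is_linear : linear mod_unit_fun.
Proof. by move=> r m m'; apply: homZ_ext => x; rewrite /= mod_tensDl mod_tensZ. Qed.
HB.instance Definition _ := GRing.isLinear.Build R^c M (homZ N (mod_tensor N))
  *:%R mod_unit_fun mod_unit_is_linear.
Definition mod_unit : {linear M -> homZ N (mod_tensor N)} := mod_unit_fun.

(* M (x)_R - is left adjoint to Hom_Z. *)
Lemma mod_tensor_adj (G : zmodType) (f : {linear M -> homZ N G}) :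
  exists! h : homZ (mod_tensor N) G, forall m x, h (mod_unit m x) = f m x.
Proof.
have Hb : mod_balanced (fun p : M * N => f p.1 p.2) by exists f.
exists (fs_lift Hb : homZ (mod_tensor N) G); split=> [m x|h Hh].
  by rewrite fs_lift_gen.
by apply: homZ_ext; apply: fs_hom_ext => -[m x]; rewrite fs_lift_gen -Hh.
Qed.
End Unit.

Section Map.
Variables (N N' : lmodType R) (f : {linear N -> N'}).

Lemma mod_tensor_map_balanced :
  mod_balanced (fun p : M * N => mod_tens p.1 (f p.2)).
Proof. by exists (homZ_pre (mod_tensor N') f \o mod_unit N'). Qed.

Definition mod_tensor_map : {additive mod_tensor N -> mod_tensor N'} :=
  fs_lift mod_tensor_map_balanced.

Lemma mod_tensor_mapE m x : mod_tensor_map (mod_tens m x) = mod_tens m (f x).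
Proof. exact: fs_lift_gen. Qed.
End Map.

End ModuleTensor.

Section RepTensor.
Variables (Q : quiver) (R : pzRingType) (S : rep (op_quiver Q) R^c).
Implicit Types X : rep Q R.

Definition rep_elt X := {i : Q & (S i * X i)%type}.

Definition rep_balanced X (G : zmodType) (b : rep_elt X -> G) : Prop :=
  exists f : rep_hom S (hom_rep X G),
    forall t, b t = f (tag t) (tagged t).1 (tagged t).2.

Definition rep_tensor X : zmodType := fsum (@rep_balanced X).
Definition rep_tens X i (s : S i) (x : X i) : rep_tensor X :=
  fs_gen (@rep_balanced X) (existT (fun i => (S i * X i)%type) i (s, x)).

Lemma rep_tensDl X i (s s' : S i) (x : X i) :
  rep_tens (s + s') x = rep_tens s x + rep_tens s' x.
Proof.
apply: fs_ext => G b Hb; case: (Hb) => f E.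
by rewrite [RHS]fs_evalD // !fs_eval_gen // !E /= raddfD.
Qed.
Lemma rep_tensDr X i (s : S i) (x x' : X i) :
  rep_tens s (x + x') = rep_tens s x + rep_tens s x'.
Proof.
apply: fs_ext => G b Hb; case: (Hb) => f E.
by rewrite [RHS]fs_evalD // !fs_eval_gen // !E /= raddfD.
Qed.
Lemma rep_tensZ X i (r : R) (s : S i) (x : X i) :
  rep_tens ((r : R^c) *: s) x = rep_tens s (r *: x).
Proof.
apply: fs_ext => G b Hb; case: (Hb) => f E.
by rewrite !fs_eval_gen // !E /= linearZ.
Qed.
Lemma rep_tens_arrow X i j (a : @arrow Q i j) (s : S j) (x : X i) :
  rep_tens (@rep_map _ _ S j i a s) x = rep_tens s (rep_map X a x).
Proof.
apply: fs_ext => G b Hb; case: (Hb) => f E.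
by rewrite !fs_eval_gen // !E /= (@rep_hom_nat _ _ _ _ f j i a).
Qed.

Section Unit.
Variable X : rep Q R.

Section At.
Variables (i : Q) (s : S i).
Lemma rep_tens_is_zmod_morphism : zmod_morphism (@rep_tens X i s).
Proof.
have tens0 : rep_tens s (0 : X i) = 0.
  by apply: (addrI (rep_tens s 0)); rewrite -rep_tensDr !addr0.
move=> x y; rewrite rep_tensDr; congr (_ + _); apply: (addrI (rep_tens s y)).
by rewrite -rep_tensDr !subrr.
Qed.
HB.instance Definition _ := GRing.isZmodMorphism.Build (X i) (rep_tensor X)
  (@rep_tens X i s) rep_tens_is_zmod_morphism.
End At.

Section AtVertex.
Variable i : Q.
Definition rep_unit_fun (s : S i) : homZ (X i) (rep_tensor X) :=
  (@rep_tens X i s : {additive X i -> rep_tensor X}).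
Lemma rep_unit_is_linear : linear rep_unit_fun.
Proof. by move=> r s s'; apply: homZ_ext => x; rewrite /= rep_tensDl rep_tensZ. Qed.
HB.instance Definition _ := GRing.isLinear.Build R^c (S i)
  (homZ (X i) (rep_tensor X)) *:%R rep_unit_fun rep_unit_is_linear.
Definition rep_unit_at : {linear S i -> homZ (X i) (rep_tensor X)} := rep_unit_fun.
End AtVertex.

Lemma rep_unit_nat (i j : op_quiver Q) (a : arrow i j) (s : S i) :
  rep_unit_at j (rep_map S a s) =
  rep_map (hom_rep X (rep_tensor X)) a (rep_unit_at i s).
Proof. by apply: homZ_ext => x; apply: rep_tens_arrow. Qed.

Definition rep_unit : rep_hom S (hom_rep X (rep_tensor X)) :=
  @RepHom _ _ S (hom_rep X (rep_tensor X)) rep_unit_at rep_unit_nat.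

(* [rep_unit] is universal from S to the functor G |-> Hom(X, G), so that      *)
(* S |-> [rep_tensor S X] is left adjoint to that functor.                     *)
Lemma rep_tensor_adj (G : zmodType) (f : rep_hom S (hom_rep X G)) :
  exists! h : homZ (rep_tensor X) G,
    forall (i : Q) (s : S i) (x : X i), h (rep_unit i s x) = f i s x.
Proof.
have Hb : rep_balanced (fun t : rep_elt X => f (tag t) (tagged t).1 (tagged t).2).
  by exists f.
exists (fs_lift Hb : homZ (rep_tensor X) G); split=> [i s x|h Hh].
  by rewrite fs_lift_gen.
by apply: homZ_ext; apply: fs_hom_ext => -[i [s x]]; rewrite fs_lift_gen -Hh.
Qed.
End Unit.

Section Map.
Variables (X Y : rep Q R) (f : rep_hom X Y).

Definition rep_tensor_map_at (i : op_quiver Q) :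
    {linear S i -> homZ (X i) (rep_tensor Y)} :=
  homZ_pre (rep_tensor Y) (f i) \o rep_unit Y i.

Lemma rep_tensor_map_nat (i j : op_quiver Q) (a : arrow i j) (s : S i) :
  rep_tensor_map_at j (rep_map S a s) =
  rep_map (hom_rep X (rep_tensor Y)) a (rep_tensor_map_at i s).
Proof.
apply: homZ_ext => x.
have -> : rep_tensor_map_at j (rep_map S a s) x =
  rep_tens (rep_map S a s) (f j x) by [].
by rewrite (@rep_tens_arrow Y j i a) /= -(@rep_hom_nat Q R X Y f j i a).
Qed.

Lemma rep_tensor_map_balanced :
  rep_balanced (fun t : rep_elt X => rep_tens (tagged t).1 (f (tag t) (tagged t).2)).
Proof.
by exists (@RepHom _ _ S (hom_rep X (rep_tensor Y)) rep_tensor_map_at rep_tensor_map_nat).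
Qed.

Definition rep_tensor_map : {additive rep_tensor X -> rep_tensor Y} :=
  fs_lift rep_tensor_map_balanced.

Lemma rep_tensor_mapE i (s : S i) (x : X i) :
  rep_tensor_map (rep_tens s x) = rep_tens s (f i x).
Proof. exact: fs_lift_gen. Qed.
End Map.

End RepTensor.

Section Exactness.

(* 0 -> A -> B -> C -> 0 is exact. *)
Definition short_exact (A B C : zmodType) (f : A -> B) (g : B -> C) : Prop :=
  [/\ injective f,
      forall y, g y = 0 <-> exists x, f x = y
    & forall z, exists y, g y = z].

Variable R : pzRingType.

Definition pure_mod_ses (U V W : lmodType R)
    (f : {linear U -> V}) (g : {linear V -> W}) : Prop :=
  short_exact f g /\
  forall M : lmodType R^c, short_exact (mod_tensor_map M f) (mod_tensor_map M g).

Definition pure_epi (V W : lmodType R) (g : {linear V -> W}) : Prop :=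
  (forall z, exists y, g y = z) /\ pure_mod_ses (ker_incl g) g.

Variable Q : quiver.

Definition pure_rep_ses (X Y Z : rep Q R)
    (f : rep_hom X Y) (g : rep_hom Y Z) : Prop :=
  (forall i, short_exact (f i) (g i)) /\
  forall S : rep (op_quiver Q) R^c,
    short_exact (rep_tensor_map S f) (rep_tensor_map S g).

(* 0 -> A 0 -> A 1 -> ... is exact, and each of the short exact sequences      *)
(* 0 -> ker (d n) -> A n -> ker (d n.+1) -> 0 is pure.                         *)
Definition pure_exact_seq (A : nat -> rep Q R)
    (d : forall n, rep_hom (A n) (A n.+1)) : Prop :=
  [/\ forall i, injective (d 0%N i),
      forall n i y, d n.+1 i y = 0 <-> exists x, d n i x = y
    & exists dd0 : forall n i x, d n.+1 i (d n i x) = 0,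
        forall n, pure_rep_ses (ker_rep_incl (d n)) (ker_rep_lift (dd0 n))].

(* Monomorphisms of representations are the componentwise injective maps.      *)
Definition injective_rep (E : rep Q R) : Prop :=
  forall (X Y : rep Q R) (f : rep_hom X Y) (g : rep_hom X E),
    (forall i, injective (f i)) ->
    exists h : rep_hom Y E, forall i x, h i (f i x) = g i x.

Definition coaugmented (X : rep Q R) (E : nat -> rep Q R) (n : nat) : rep Q R :=
  if n is m.+1 then E m else X.

Definition strongly_fp_injective_rep (X : rep Q R) : Prop :=
  exists (E : nat -> rep Q R)
         (d : forall n, rep_hom (coaugmented X E n) (coaugmented X E n.+1)),
    (forall n, injective_rep (E n)) /\ pure_exact_seq d.

Section Psi.
Variables (X : rep Q R) (i : Q).

Definition psi_fun (x : X i) : dprod (fun a : out_arrow i => X (tag a)) :=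
  fun a => rep_map X (tagged a) x.

Lemma psi_is_linear : linear psi_fun.
Proof.
by move=> r x y; apply: functional_extensionality_dep => a; rewrite /psi_fun linearP.
Qed.
HB.instance Definition _ := GRing.isLinear.Build R (X i)
  (dprod (fun a : out_arrow i => X (tag a))) *:%R psi_fun psi_is_linear.

Definition psi : {linear X i -> dprod (fun a : out_arrow i => X (tag a))} :=
  psi_fun.
End Psi.

End Exactness.

Section Projective.
Variable R : pzRingType.
Implicit Types P L : lmodType R.

Definition projective P : Prop :=
  forall (V W : lmodType R) (g : {linear V -> W}) (f : {linear P -> W}),
    (forall z, exists y, g y = z) ->
    exists h : {linear P -> V}, forall x, g (h x) = f x.

Record proj_resolution P := ProjResolution {
  pr_obj :> nat -> lmodType R;
  pr_d : forall n, {linear pr_obj n.+1 -> pr_obj n};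
  pr_aug : {linear pr_obj 0%N -> P};
  pr_projective : forall n, projective (pr_obj n);
  pr_aug_surj : forall z, exists y, pr_aug y = z;
  pr_aug_exact : forall y, pr_aug y = 0 <-> exists x, pr_d 0%N x = y;
  pr_exact : forall n y, pr_d n y = 0 <-> exists x, pr_d n.+1 x = y }.

End Projective.
Arguments pr_d {R P} F n : rename.

Section FreeModule.
Variables (R : pzRingType) (T : Type).

Definition fin_supp : pred ({classic T} -> R^o) :=
  fun u => `[< finite_set [set t | u t <> 0]%classic >].

Lemma fin_supp_submod_closed : submod_closed fin_supp.
Proof.
split=> [|r u v]; rewrite !unfold_in.
  by apply/asboolP; rewrite (_ : [set t | _] = set0)%classic // -subset0.
move=> /asboolP Hu /asboolP Hv; apply/asboolP.
have HU : finite_set ([set t | u t <> 0] `|` [set t | v t <> 0])%classic.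
  by rewrite finite_setU.
apply: sub_finite_set HU => t /= Hn.
have [u0|] := pselect (u t = 0); last by left.
by right=> v0; apply: Hn; rewrite -[LHS]/(r *: u t + v t) u0 v0 scaler0 addr0.
Qed.
HB.instance Definition _ :=
  GRing.isSubmodClosed.Build R ({classic T} -> R^o) fin_supp fin_supp_submod_closed.

Record free_mod := FreeMod { free_val :> {classic T} -> R^o; _ : free_val \in fin_supp }.
HB.instance Definition _ := [isSub for free_val].
HB.instance Definition _ := [Choice of free_mod by <:].
HB.instance Definition _ := [SubChoice_isSubLmodule of free_mod by <:].

Section Extend.
Variables (V : lmodType R) (a : {classic T} -> V).

Definition free_ext_fun (u : free_mod) : V := \sum_(t \in [set: {classic T}]%classic) (u t : R) *: a t.

Lemma free_ext_finite (u : free_mod) :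
  finite_set [set t | u t <> 0]%classic.
Proof. by case: u => u /= /asboolP. Qed.

Lemma free_ext_widen (u : free_mod) (D : set {classic T}) :
  finite_set D -> ([set t | u t <> 0] `<=` D)%classic ->
  free_ext_fun u = \sum_(t \in D) (u t : R) *: a t.
Proof.
move=> fD sD; rewrite /free_ext_fun; symmetry; apply: fsbig_widen => // t [_ /= Dt].
have [->|/sD//] := pselect (u t = 0).
by rewrite scale0r.
Qed.

Lemma free_ext_is_linear : linear free_ext_fun.
Proof.
move=> r u v.
set D := ([set t | u t <> 0%R] `|` [set t | v t <> 0%R])%classic.
have fD : finite_set D by rewrite finite_setU; split; exact: free_ext_finite.
rewrite (@free_ext_widen u D) // ; last by left.
rewrite (@free_ext_widen v D) // ; last by right.
rewrite (@free_ext_widen _ D) //; last first.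
  move=> t /= Hn; have [u0|] := pselect (u t = 0); last by left.
  by right=> v0; apply: Hn; rewrite -[LHS]/(r *: u t + v t) u0 v0 scaler0 addr0.
rewrite !fsbig_finite // scaler_sumr -big_split; apply: eq_bigr => t _.
by rewrite [RHS]/= scalerA -scalerDl.
Qed.
HB.instance Definition _ :=
  GRing.isLinear.Build R free_mod V *:%R free_ext_fun free_ext_is_linear.
Definition free_ext : {linear free_mod -> V} := free_ext_fun.
End Extend.

Lemma free_gen_subproof (t : {classic T}) :
  (fun s : {classic T} => (s == t)%:R : R^o) \in fin_supp.
Proof.
rewrite unfold_in; apply/asboolP/(sub_finite_set _ (finite_set1 t)) => s /=.
by case: eqP.
Qed.
Definition free_gen (t : T) : free_mod := FreeMod (free_gen_subproof t).

Lemma free_ext_gen (V : lmodType R) (a : {classic T} -> V) t :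
  free_ext a (free_gen t) = a t.
Proof.
rewrite -[LHS]/(free_ext_fun a (free_gen t)) (@free_ext_widen _ _ _ [set (t : {classic T})]%classic) //.
  by rewrite fsbig_set1 /= eqxx scale1r.
by move=> s /=; case: eqP.
Qed.

Lemma free_modE (u : free_mod) : u = free_ext free_gen u.
Proof.
have fu := free_ext_finite u.
apply: val_inj; apply/funext => s.
rewrite -[free_ext _ _]/(free_ext_fun _ _) (@free_ext_widen _ _ _ _ fu) // fsbig_finite //=.
have val_sum (r : seq {classic T}) : (free_val (\sum_(t <- r) (u t : R) *: free_gen t)) s =
    \sum_(t <- r) (u t : R) *: ((s == t)%:R : R^o).
  elim: r => [|t r IH]; first by rewrite !big_nil.
  by rewrite !big_cons -IH.
rewrite val_sum.
have [us0|us0] := pselect (u s = 0).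
  rewrite us0 big1 // => t _; case: eqP => [<-|_]; rewrite ?us0 ?scale0r ?scaler0 //.
rewrite (bigD1_seq s) ?fset_uniq //=; last by rewrite in_fset_set // inE.
rewrite eqxx big1 ?addr0 => [|t /negbTE nts].
  by rewrite /GRing.scale /= mulr1.
by rewrite eq_sym nts scaler0.
Qed.

Lemma free_mod_projective : projective free_mod.
Proof.
move=> V W g f gs.
have /choice[a Ha] : forall t : T, exists y, g y = f (free_gen t) by move=> t; apply: gs.
exists (free_ext a) => u; rewrite [in RHS](free_modE u).
have fu := free_ext_finite u.
rewrite -[free_ext a u]/(free_ext_fun a u) -[free_ext _ u]/(free_ext_fun free_gen u).
rewrite !(free_ext_widen _ fu) // !fsbig_finite // !raddf_sum.
by apply: eq_bigr => t _; rewrite /= !linearZ /= Ha.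
Qed.

End FreeModule.

Section ResolutionExists.
Variables (R : pzRingType) (P : lmodType R).

Definition free_cover (V : lmodType R) : {linear free_mod R V -> V} :=
  free_ext (id : {classic V} -> V).

Lemma free_cover_surj V z : exists y, free_cover V y = z.
Proof. by exists (free_gen R z); rewrite /free_cover free_ext_gen. Qed.

Record stage := Stage {
  stage_src : lmodType R; stage_tgt : lmodType R;
  stage_map : {linear stage_src -> stage_tgt} }.

Definition next_stage (s : stage) : stage :=
  @Stage (free_mod R (ker (stage_map s))) (stage_src s)
    (ker_incl (stage_map s) \o free_cover (ker (stage_map s))).

Fixpoint std_stage n : stage :=
  if n is m.+1 then next_stage (std_stage m) else Stage (free_cover P).

Lemma next_stage_exact s y : stage_map s y = 0 <->
  exists x, stage_map (next_stage s) x = y.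
Proof.
split=> [sy0|[x <-]]; last exact: kerP.
have [x Hx] := free_cover_surj (@Ker _ _ _ (stage_map s) y (introT eqP sy0)).
by exists x; rewrite /= Hx.
Qed.

Lemma proj_resolution_exists : inhabited (proj_resolution P).
Proof.
constructor; apply: (@ProjResolution R P (fun n => stage_src (std_stage n))
  (fun n => stage_map (std_stage n.+1)) (stage_map (std_stage 0))).
- by case=> [|n]; exact: free_mod_projective.
- exact: free_cover_surj.
- exact: next_stage_exact.
- move=> n y; exact (next_stage_exact (s := std_stage n.+1) y).
Qed.
End ResolutionExists.

Section Ext.
Variable R : pzRingType.
Implicit Types P L : lmodType R.

Definition cocycle P L (F : proj_resolution P) n (c : {linear F n -> L}) : Prop :=
  forall x, c (pr_d F n x) = 0.

Definition coboundary P L (F : proj_resolution P) n :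
    {linear F n -> L} -> Prop :=
  match n with
  | 0 => fun c => forall x, c x = 0
  | m.+1 => fun c => exists b : {linear F m -> L}, forall x, c x = b (pr_d F m x)
  end.

(* Ext^n_R(P, L) = 0, i.e. H^n(Hom_R(F, L)) = 0 for projective resolutions F   *)
(* of P; such F exist, by [proj_resolution_exists].                            *)
Definition Ext_eq0 n P L : Prop :=
  forall (F : proj_resolution P) (c : {linear F n -> L}),
    cocycle c -> coboundary c.

Definition finitely_presented P : Prop :=
  exists m n (f : {linear 'rV[R]_m -> 'rV[R]_n}) (g : {linear 'rV[R]_n -> P}),
    (forall y, g y = 0 <-> exists x, f x = y) /\ (forall z, exists y, g y = z).

Definition strongly_fp_injective L : Prop :=
  forall P, finitely_presented P -> forall n, (1 <= n)%N -> Ext_eq0 n P L.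

End Ext.

(* Main.v *)
(** Purity is traded for solvability of finite linear systems.  If S (x) f is
    injective for all S, where f : X -> Y, then taking S = Hom(X, G) with G the
    cokernel of a finite system over X shows that every such system solvable in
    Y is solvable in X; the equations may involve both scalars and the maps
    X(a), for finitely many arrows a.

    An injective representation is a retract of a product of cofree ones, hence
    is injective at each vertex and its psi has a linear section.  Therefore,
    when X embeds purely in an injective E, a homogeneous system solved in the
    product of the X(t(a)) is solved in E(i) via the section, hence in X(i)
    compatibly with psi, and psi is a pure epimorphism; dimension shifting along
    the resolution at the vertex i gives the vanishing of Ext.

    Conversely, let the X(i) be strongly fp-injective and the psi_i pure
    epimorphisms.  These properties pass to the cokernel C of an embedding of X
    in an injective representation E, so it suffices that the embedding is pure.
    As Q is right rooted, the natural maps Y -> X that retract X -> Y up to any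
    given finite set of linear relations can be built vertex by vertex, by
    well-founded recursion along the arrows.  Together they define an additive
    map from S (x) Y to a reduced power of S (x) X whose restriction to S (x) X
    is the diagonal, so S (x) X -> S (x) Y is injective. *)

From HB Require Import structures.
Require Import Defs.
From mathcomp Require Import all_boot all_algebra generic_quotient.
From mathcomp Require Import boolp classical_sets functions cardinality.

Set Implicit Arguments.
Unset Strict Implicit.
Unset Printing Implicit Defensive.

Import GRing.Theory Num.Theory.
Local Open Scope ring_scope.
Local Open Scope quotient_scope.

(** * Bundled maps, and quotients of abelian groups and modules *)

Section MakeLinear.
Variables (R : pzRingType) (U V : lmodType R) (f : U -> V) (lin_f : linear f).

(** The proof is an argument so that the linear structure can be attached to this constant and found
    again by unification. *)
Definition linear_of_fun (_ : linear f) := f.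
HB.instance Definition _ :=
  GRing.isLinear.Build R U V *:%R (linear_of_fun lin_f) lin_f.
Definition linear_of : {linear U -> V} := linear_of_fun lin_f.

End MakeLinear.

Section MakeAdditive.
Variables (U V : zmodType) (f : U -> V) (add_f : zmod_morphism f).

Definition additive_of_fun (_ : zmod_morphism f) := f.
HB.instance Definition _ :=
  GRing.isZmodMorphism.Build U V (additive_of_fun add_f) add_f.
Definition additive_of : {additive U -> V} := additive_of_fun add_f.

End MakeAdditive.

Section ZmodQuotient.
Variables (A : zmodType) (P : A -> Prop).

Definition subgroup := P 0 /\ forall x y, P x -> P y -> P (x - y).

Hypothesis sgP : subgroup.

Lemma subgroupN x : P x -> P (- x).
Proof. by move=> Px; rewrite -[- x]add0r; apply: sgP.2 => //; exact: sgP.1. Qed.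

Lemma subgroupD x y : P x -> P y -> P (x + y).
Proof. by move=> Px Py; rewrite -[y]opprK; apply: sgP.2 => //; exact: subgroupN. Qed.

Definition zq_rel (_ : subgroup) (x y : A) : bool := `[< P (x - y) >].

Lemma zq_rel_refl : reflexive (zq_rel sgP).
Proof. by move=> x; apply/asboolP; rewrite subrr; exact: sgP.1. Qed.
Lemma zq_rel_sym : symmetric (zq_rel sgP).
Proof. by move=> x y; apply/asboolP/asboolP => /subgroupN; rewrite opprB. Qed.
Lemma zq_rel_trans : transitive (zq_rel sgP).
Proof.
move=> y x z /asboolP xy /asboolP yz; apply/asboolP.
by have := subgroupD xy yz; rewrite addrA subrK.
Qed.
Canonical zq_equiv :=
  EquivRel (zq_rel sgP) zq_rel_refl zq_rel_sym zq_rel_trans.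

Definition zquot := {eq_quot zq_rel sgP}.

Definition zq_proj (x : A) : zquot := \pi_zquot x.

Lemma zq_projP x y : zq_proj x = zq_proj y <-> P (x - y).
Proof.
split=> [|xy]; first by move/eqmodP/asboolP.
by apply/eqmodP/asboolP.
Qed.

Lemma zq_reprP x : P (repr (zq_proj x) - x).
Proof. by apply/zq_projP; rewrite /zq_proj reprK. Qed.

Lemma zq_proj_surj u : zq_proj (repr u) = u.
Proof. exact: reprK. Qed.

Definition zq_add (u v : zquot) := zq_proj (repr u + repr v).
Definition zq_opp (u : zquot) := zq_proj (- repr u).

Lemma zq_addE x y : zq_add (zq_proj x) (zq_proj y) = zq_proj (x + y).
Proof.
apply/zq_projP; rewrite opprD addrACA.
by apply: subgroupD; exact: zq_reprP.
Qed.
Lemma zq_oppE x : zq_opp (zq_proj x) = zq_proj (- x).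
Proof.
by apply/zq_projP; rewrite -opprD; apply/subgroupN/zq_reprP.
Qed.

Lemma zq_ind (K : zquot -> Prop) : (forall x, K (zq_proj x)) -> forall u, K u.
Proof. by move=> H u; rewrite -[u]zq_proj_surj. Qed.

Lemma zq_addA : associative zq_add.
Proof.
by elim/zq_ind=> x; elim/zq_ind=> y; elim/zq_ind=> z; rewrite !zq_addE addrA.
Qed.
Lemma zq_addC : commutative zq_add.
Proof. by elim/zq_ind=> x; elim/zq_ind=> y; rewrite !zq_addE addrC. Qed.
Lemma zq_add0 : left_id (zq_proj 0) zq_add.
Proof. by elim/zq_ind=> x; rewrite !zq_addE add0r. Qed.
Lemma zq_addN : left_inverse (zq_proj 0) zq_opp zq_add.
Proof. by elim/zq_ind=> x; rewrite zq_oppE zq_addE addNr. Qed.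

HB.instance Definition _ := Choice.on zquot.
HB.instance Definition _ :=
  GRing.isZmodule.Build zquot zq_addA zq_addC zq_add0 zq_addN.

Lemma zq_proj_is_zmod_morphism : zmod_morphism zq_proj.
Proof.
by move=> x y; rewrite -[RHS]/(zq_add _ (zq_opp _)) zq_oppE zq_addE.
Qed.
HB.instance Definition _ :=
  GRing.isZmodMorphism.Build A zquot zq_proj zq_proj_is_zmod_morphism.

Lemma zq_proj_eq0 x : zq_proj x = 0 <-> P x.
Proof. by rewrite -[0]/(zq_proj 0) zq_projP subr0. Qed.

End ZmodQuotient.

Section LmodQuotient.
Variables (R : pzRingType) (V : lmodType R) (P : V -> Prop).
Hypothesis sgP : subgroup P.
Hypothesis scP : forall r x, P x -> P (r *: x).

Definition lquot (_ : forall r x, P x -> P (r *: x)) := zquot sgP.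
HB.instance Definition _ := GRing.Zmodule.on (lquot scP).

Definition lq_proj_fun (x : V) : lquot scP := zq_proj sgP x.
Definition lq_scale (r : R) (u : lquot scP) : lquot scP :=
  lq_proj_fun (r *: repr u).

Lemma lq_ind (K : lquot scP -> Prop) :
  (forall x, K (lq_proj_fun x)) -> forall u, K u.
Proof. exact: zq_ind. Qed.

Lemma lq_scaleE r x : lq_scale r (lq_proj_fun x) = lq_proj_fun (r *: x).
Proof.
by apply/(zq_projP sgP); rewrite -scalerBr; apply: scP; exact: zq_reprP.
Qed.

Lemma lq_projD x y : lq_proj_fun (x + y) = lq_proj_fun x + lq_proj_fun y.
Proof. exact: raddfD. Qed.

Lemma lq_scaleA a b u : lq_scale a (lq_scale b u) = lq_scale (a * b) u.
Proof. by elim/lq_ind: u => x; rewrite !lq_scaleE scalerA. Qed.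
Lemma lq_scale1 : left_id 1 lq_scale.
Proof. by elim/lq_ind=> x; rewrite lq_scaleE scale1r. Qed.
Lemma lq_scaleDr : right_distributive lq_scale +%R.
Proof.
move=> r; elim/lq_ind=> x; elim/lq_ind=> y.
by rewrite -[_ + _]lq_projD !lq_scaleE scalerDr lq_projD.
Qed.
Lemma lq_scaleDl u : {morph lq_scale^~ u : a b / a + b}.
Proof.
by move=> a b; elim/lq_ind: u => x; rewrite !lq_scaleE scalerDl lq_projD.
Qed.
HB.instance Definition _ := GRing.Zmodule_isLmodule.Build R (lquot scP)
  lq_scaleA lq_scale1 lq_scaleDr lq_scaleDl.

Lemma lq_proj_is_linear : linear lq_proj_fun.
Proof. by move=> r x y; rewrite lq_projD -lq_scaleE. Qed.
HB.instance Definition _ :=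
  GRing.isLinear.Build R V (lquot scP) *:%R lq_proj_fun lq_proj_is_linear.
Definition lq_proj : {linear V -> lquot scP} := lq_proj_fun.

Lemma lq_proj_eq0 x : lq_proj x = 0 <-> P x.
Proof. exact: zq_proj_eq0. Qed.

Lemma lq_proj_surj u : exists x, lq_proj x = u.
Proof. by exists (repr u); exact: zq_proj_surj. Qed.

End LmodQuotient.

(** For any set-theoretic section [s] of [f], the value of [h] at [s (f x)] is [h x], which makes
    [h \o s] linear. *)
Lemma linear_factor (R : pzRingType) (U V W : lmodType R)
    (f : {linear U -> V}) (h : {linear U -> W}) :
  (forall y, exists x, f x = y) -> (forall x, f x = 0 -> h x = 0) ->
  exists k : {linear V -> W}, forall x, k (f x) = h x.
Proof.
move=> /choice[s fs] fh0.
have hs x : h (s (f x)) = h x.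
  by apply/eqP; rewrite -subr_eq0 -raddfB; apply/eqP/fh0; rewrite raddfB /= fs subrr.
have lin_hs : linear (h \o s).
  by move=> r x y; rewrite /= -{1}[x]fs -{1}[y]fs -linearP hs linearP.
by exists (linear_of lin_hs).
Qed.

Lemma additive_injective (U V : zmodType) (f : {additive U -> V}) :
  (forall x, f x = 0 -> x = 0) -> injective f.
Proof.
move=> f0 x y /eqP; rewrite -subr_eq0 -raddfB => /eqP/f0/eqP.
by rewrite subr_eq0 => /eqP.
Qed.
Lemma zmod_morphism_of_add (U V : zmodType) (f : U -> V) :
  {morph f : x y / x + y} -> zmod_morphism f.
Proof.
move=> fD x y; apply: (addIr (f y)); rewrite -fD !subrK //.
Qed.

(** * The universal property in elementwise form, and right exactness of the tensor product *)

Section RepTensorMaps.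
Variables (Q : quiver) (R : pzRingType) (S : rep (op_quiver Q) R^c).

Lemma rep_tensor_lift (X : rep Q R) (G : zmodType)
    (b : forall i : Q, S i -> X i -> G) :
  (forall i s, {morph b i s : x y / x + y}) ->
  (forall i s s' x, b i (s + s') x = b i s x + b i s' x) ->
  (forall i (r : R) s x, b i ((r : R^c) *: s) x = b i s (r *: x)) ->
  (forall i j (a : @arrow Q i j) (s : S j) x,
     b i (@rep_map _ _ S j i a s) x = b j s (rep_map X a x)) ->
  exists h : {additive rep_tensor S X -> G},
    forall i (s : S i) (x : X i), h (rep_tens s x) = b i s x.
Proof.
move=> bDr bDl bZ barr.
pose b1 (i : Q) (s : S i) : homZ (X i) G :=
  additive_of (zmod_morphism_of_add (bDr i s)).
have lin_b1 i : linear (b1 i).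
  by move=> r s s'; apply: homZ_ext => x; rewrite /= /additive_of_fun bDl bZ.
have nat_b1 (i j : op_quiver Q) (a : arrow i j) (s : S i) :
    linear_of (lin_b1 j) (rep_map S a s) =
    rep_map (hom_rep X G) a (linear_of (lin_b1 i) s).
  by apply: homZ_ext => x; apply: barr.
have bal : rep_balanced (fun t : rep_elt S X => b (tag t) (tagged t).1 (tagged t).2).
  by exists (@RepHom _ _ S (hom_rep X G) (fun i => linear_of (lin_b1 i)) nat_b1).
by exists (fs_lift bal) => i s x; rewrite fs_lift_gen.
Qed.

Lemma rep_tensor_hom_ext (X : rep Q R) (G : zmodType)
    (h k : {additive rep_tensor S X -> G}) :
  (forall i (s : S i) (x : X i), h (rep_tens s x) = k (rep_tens s x)) ->
  forall u, h u = k u.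
Proof. by move=> H; apply: fs_hom_ext => -[i [s x]]; exact: H. Qed.

(** The projection onto the quotient by [P] kills every generator, so it is zero. *)
Lemma rep_tensor_ind (X : rep Q R) (P : rep_tensor S X -> Prop) :
  subgroup P -> (forall i (s : S i) (x : X i), P (rep_tens s x)) -> forall u, P u.
Proof.
move=> sgP Pt u; rewrite -(zq_proj_eq0 sgP).
pose h : {additive rep_tensor S X -> zquot sgP} := zq_proj sgP.
apply: (@rep_tensor_hom_ext _ _ h (\0)%R _ u) => i s x.
by apply/(zq_proj_eq0 sgP)/Pt.
Qed.

Lemma subgroup_image (U V : zmodType) (f : {additive U -> V}) :
  subgroup (fun y => exists x, f x = y).
Proof.
split=> [|_ _ [x <-] [y <-]]; first by exists 0; rewrite raddf0.
by exists (x - y); rewrite raddfB.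
Qed.

Section RightExact.
Variables (X Y Z : rep Q R) (f : rep_hom X Y) (g : rep_hom Y Z).
Hypothesis g_surj : forall i z, exists y, g i y = z.

Lemma rep_tensor_map_surj z : exists y, rep_tensor_map S g y = z.
Proof.
apply: (rep_tensor_ind (subgroup_image (rep_tensor_map S g))) => i s x.
by have [y <-] := g_surj x; exists (rep_tens s y); rewrite rep_tensor_mapE.
Qed.

Hypothesis fg_exact : forall i y, g i y = 0 <-> exists x, f i x = y.

(** The projection of S (x) Y onto the cokernel of [rep_tensor_map S f] factors through
    [rep_tensor_map S g]: send s (x) z to the class of s (x) y for any lift y of z along [g].
    Exactness at Y makes this class independent of the lift. *)
Lemma rep_tensor_map_exact y :
  rep_tensor_map S g y = 0 <-> exists x, rep_tensor_map S f x = y.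
Proof.
split=> [gy0|[x <-]]; last first.
  pose h : {additive rep_tensor S X -> rep_tensor S Z} :=
    (rep_tensor_map S g \o rep_tensor_map S f).
  apply: (@rep_tensor_hom_ext X _ h (\0)%R _ x) => i s x1.
  rewrite /h /=  !rep_tensor_mapE.
  have -> : g i (f i x1) = 0 by apply/fg_exact; exists x1.
  exact: raddf0.
have sgI := subgroup_image (rep_tensor_map S f).
pose b i (s : S i) (z : Z i) := zq_proj sgI (rep_tens s (projT1 (cid (g_surj z)))).
have bE i s y0 : b i s (g i y0) = zq_proj sgI (rep_tens s y0).
  apply/(zq_projP sgI); rewrite -raddfB.
  case: cid => y1 /= /eqP; rewrite -subr_eq0 -raddfB => /eqP/fg_exact[x <-].
  by exists (rep_tens s x); rewrite rep_tensor_mapE.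
have [||||h hE] := @rep_tensor_lift Z (zquot sgI) b.
- move=> i s z z'; have [y1 <-] := g_surj z; have [y2 <-] := g_surj z'.
  by rewrite -raddfD !bE !raddfD.
- move=> i s s' z; have [y1 <-] := g_surj z.
  by rewrite !bE rep_tensDl raddfD.
- move=> i r s z; have [y1 <-] := g_surj z.
  by rewrite -linearZ !bE rep_tensZ.
- move=> i j a s z; have [y1 <-] := g_surj z.
  by rewrite -rep_hom_nat !bE rep_tens_arrow.
apply/(zq_proj_eq0 sgI).
pose q : {additive rep_tensor S Y -> zquot sgI} := zq_proj sgI.
have <- : h (rep_tensor_map S g y) = zq_proj sgI y.
  apply: (@rep_tensor_hom_ext Y _ (h \o rep_tensor_map S g) q _ y) => i s x.
  by rewrite /= rep_tensor_mapE hE bE.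
by rewrite gy0 raddf0.
Qed.

Lemma rep_tensor_short_exact :
  injective (rep_tensor_map S f) ->
  short_exact (rep_tensor_map S f) (rep_tensor_map S g).
Proof.
by move=> inj; split; [|exact: rep_tensor_map_exact|exact: rep_tensor_map_surj].
Qed.

End RightExact.
End RepTensorMaps.

Lemma dprod_sumE (R : pzRingType) (I : Type) (V : I -> lmodType R) (J : Type)
    (r : seq J) (P : pred J) (F : J -> dprod V) i :
  (\sum_(j <- r | P j) F j) i = \sum_(j <- r | P j) F j i.
Proof. by apply: (big_morph (fun w : dprod V => w i)). Qed.

Lemma homZ_sumE (N G : zmodType) (J : Type) (r : seq J) (P : pred J)
    (F : J -> homZ N G) x :
  (\sum_(j <- r | P j) F j) x = \sum_(j <- r | P j) F j x.
Proof. by apply: (big_morph (fun h : homZ N G => h x)). Qed.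

Section DprodFinite.
Variables (R : pzRingType) (I : finType) (V : I -> lmodType R).

Definition dprod_in (i : I) (x : V i) : dprod V := dfwith (fun j => 0 : V j) x.

Lemma dprod_in_is_zmod_morphism i : zmod_morphism (@dprod_in i).
Proof.
move=> x y; apply: functional_extensionality_dep => j.
rewrite -[RHS]/(dprod_in x j - dprod_in y j) /dprod_in.
have [->|ij] := eqVneq j i; first by rewrite !dfwith_in.
by rewrite !dfwith_out 1?eq_sym // subr0.
Qed.
HB.instance Definition _ i :=
  GRing.isZmodMorphism.Build (V i) (dprod V) (@dprod_in i)
    (@dprod_in_is_zmod_morphism i).

Lemma dprod_decomp (w : dprod V) : w = \sum_i dprod_in (w i).
Proof.
apply: functional_extensionality_dep => j; rewrite dprod_sumE (bigD1 j) //=.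
rewrite [X in X + _]dfwith_in big1 ?addr0 // => i ij.
by rewrite [LHS]dfwith_out.
Qed.
End DprodFinite.

Lemma rep_tens_suml (Q : quiver) (R : pzRingType) (S : rep (op_quiver Q) R^c)
    (X : rep Q R) i (x : X i) (J : Type) (r : seq J) (P : pred J) (F : J -> S i) :
  rep_tens (\sum_(j <- r | P j) F j) x = \sum_(j <- r | P j) rep_tens (F j) x.
Proof. by rewrite -[LHS]/(rep_unit_at S X i _ x) linear_sum homZ_sumE. Qed.

(** * Purity and finite linear systems *)

Section PureSystem.
Variables (Q : quiver) (R : pzRingType) (X Y : rep Q R) (f : rep_hom X Y).
Hypothesis f_pure :
  forall S : rep (op_quiver Q) R^c, injective (rep_tensor_map S f).
Variables (i : Q) (m n : nat) (A : 'M[R]_(m, n)).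
Variables (I : finType) (al : I -> out_arrow i).

(** One equation for each row of [A], and one for each pair of an arrow [al b] and an unknown,
    prescribing the image of that unknown along the arrow. *)
Let eqn := ('I_m + I * 'I_n)%type.
Let eqn_vertex (k : eqn) : Q :=
  match k with inl _ => i | inr p => tag (al p.1) end.

Let lhs (Z : rep Q R) (u : 'I_n -> Z i) : dprod (fun k => Z (eqn_vertex k)) :=
  fun k => match k with
  | inl k => \sum_j A k j *: u j
  | inr p => rep_map Z (tagged (al p.1)) (u p.2) end.

Let solvable (w : dprod (fun k => X (eqn_vertex k))) := exists u, lhs u = w.

Let sg_solvable : subgroup solvable.
Proof.
split=> [|_ _ [u <-] [v <-]].
  exists (fun=> 0); apply: functional_extensionality_dep => -[k|p] /=.
    by rewrite big1 // => j _; rewrite scaler0.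
  by rewrite linear0.
exists (fun j => u j - v j); apply: functional_extensionality_dep.
case=> [k|p] /=; rewrite -[RHS]/(lhs u _ - lhs v _) /=; last by rewrite raddfB.
by rewrite -sumrB; apply: eq_bigr => j _; rewrite scalerBr.
Qed.

(* Testing purity on [hom_rep X G] suffices: the class in G of a right-hand     *)
(* side w is the value on [\sum_k theta k (x) w k] of the evaluation map        *)
(* from Hom(X, G) (x) X to G, and this sum vanishes in Hom(X, G) (x) Y.         *)
Let G : zmodType := zquot sg_solvable.
Let S := hom_rep X G.
Let theta (k : eqn) : S (eqn_vertex k) :=
  (zq_proj sg_solvable \o @dprod_in _ _ (fun k => X (eqn_vertex k)) k
    : {additive X (eqn_vertex k) -> G}).

(** Evaluated at [x], the sum is the class of [lhs u], where [u] has [x] in position [j] and 0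
    elsewhere. This right-hand side is solvable, so its class in [G] is 0. *)
Let theta_rel (j : 'I_n) :
  \sum_k ((A k j : R^c) *: (theta (inl k) : S i)) +
  \sum_b @rep_map _ _ S _ i (tagged (al b)) (theta (inr (b, j))) = 0.
Proof.
apply: homZ_ext => x; pose u j' := if j' == j then x else 0.
rewrite -[LHS]/((_ : homZ _ _) x + (_ : homZ _ _) x) !homZ_sumE.
transitivity (zq_proj sg_solvable (lhs u)); last by apply/zq_proj_eq0; exists u.
rewrite [lhs u]dprod_decomp raddf_sum big_sumType; congr (_ + _).
  apply: eq_bigr => k _; rewrite /= /homZ_scale_fun /= /u.
  by rewrite (bigD1 j) //= eqxx big1 ?addr0 // => j' /negbTE->; rewrite scaler0.
transitivity (\sum_b \sum_j' zq_proj sg_solvable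
    (@dprod_in _ _ (fun k => X (eqn_vertex k)) (inr (b, j'))
       (rep_map X (tagged (al b)) (u j')))); last first.
  by rewrite pair_bigA; apply: eq_bigr => -[b j'].
apply: eq_bigr => b _; rewrite (bigD1 j) //= [X in _ = _ + X]big1 ?addr0.
  by rewrite /u eqxx.
by move=> j' /negbTE jj'; rewrite /u jj' linear0 !raddf0.
Qed.

Lemma pure_system (x : 'I_m -> X i) (z : forall b, 'I_n -> X (tag (al b)))
    (y : 'I_n -> Y i) :
  (forall k, \sum_j A k j *: y j = f i (x k)) ->
  (forall b j, rep_map Y (tagged (al b)) (y j) = f _ (z b j)) ->
  exists u : 'I_n -> X i,
    (forall k, \sum_j A k j *: u j = x k) /\
    (forall b j, rep_map X (tagged (al b)) (u j) = z b j).
Proof.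
move=> yx yz.
pose w : dprod (fun k => X (eqn_vertex k)) :=
  fun k => match k with inl k => x k | inr p => z p.1 p.2 end.
have [||||ev evE] := @rep_tensor_lift Q R S X G (fun i s x => (s : homZ _ _) x).
- by move=> v s; exact: raddfD.
- by [].
- by [].
- by [].
pose tau := \sum_k rep_tens (theta k) (w k).
suff tau0 : tau = 0.
  have : ev tau = 0 by rewrite tau0 raddf0.
  rewrite raddf_sum (eq_bigr (fun k => theta k (w k))) => [|k _]; last exact: evE.
  rewrite -raddf_sum -dprod_decomp => /zq_proj_eq0[u uw].
  by exists u; split=> [k|b j];
    [rewrite -[RHS]/(w (inl k)) -uw|rewrite -[RHS]/(w (inr (b, j))) -uw].
apply: (f_pure (S := S)); rewrite raddf0 raddf_sum.
transitivity (\sum_k rep_tens (theta k) (lhs y k)).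
  apply: eq_bigr => k _; rewrite rep_tensor_mapE; congr rep_tens.
  by case: k => [k|[b j]] /=; rewrite ?yx ?yz.
(* Scalars and arrows move across the tensor sign; collecting the terms in each [y j] produces the
   left factor of [theta_rel]. *)
transitivity (\sum_j rep_tens
    (\sum_k ((A k j : R^c) *: (theta (inl k) : S i)) +
     \sum_b @rep_map _ _ S _ i (tagged (al b)) (theta (inr (b, j)))) (y j)).
  under [RHS]eq_bigr => j _ do rewrite rep_tensDl !rep_tens_suml.
  rewrite big_split /= [X in _ = X + _]exchange_big [X in _ = _ + X]exchange_big.
  rewrite big_sumType; congr (_ + _).
    apply: eq_bigr => k _; rewrite raddf_sum.
    by apply: eq_bigr => j _; rewrite rep_tensZ.
  by rewrite pair_bigA; apply: eq_bigr => -[b j] _; rewrite rep_tens_arrow.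
apply: big1 => j _; rewrite theta_rel.
by rewrite -[LHS]/(rep_unit_at S Y i 0 (y j)) linear0.
Qed.
End PureSystem.

Lemma finite_set_index (T : Type) (L : set T) : finite_set L ->
  exists m (e : 'I_m -> T), forall x, L x <-> exists k, e k = x.
Proof.
move=> /(finite_seqP (T := {classic T}))[s ->].
exists (size s), (tnth (in_tuple s)) => x; split=> [xs|[k <-]].
  by have /tnthP[k ->] : (x : {classic T}) \in in_tuple s by []; exists k.
exact: mem_tnth.
Qed.

Section LinearSystems.
Variable R : pzRingType.

(** The variables form an arbitrary type [T], later the underlying set of a module with one variable
    for each element. *)
Definition term_eval (T : Type) (V : lmodType R) (v : T -> V)
    (w : seq (R * T)) : V :=
  \sum_(p <- w) p.1 *: v p.2.

(** The columns are the finitely many variables that occur, without repetition; coefficients of the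
    same variable are added up. Injectivity of [var] lets values on the columns extend to all of
    [T]. *)
Lemma terms_matrix (T : Type) (m : nat) (w : 'I_m -> seq (R * T)) :
  exists n (var : 'I_n -> T) (A : 'M[R]_(m, n)), injective var /\
    forall (V : lmodType R) (v : T -> V) k,
      term_eval v (w k) = \sum_j A k j *: v (var j).
Proof.
pose w' k : seq (R * {classic T}) := w k.
pose s := undup [seq p.2 | k <- enum 'I_m, p <- w' k].
pose var (j : 'I_(size s)) : {classic T} := tnth (in_tuple s) j.
exists (size s), var, (\matrix_(k, j) \sum_(p <- w' k | var j == p.2) p.1).
have var_inj : injective var.
  by move=> i j; rewrite /var => /(tuple_uniqP (in_tuple s) (undup_uniq _)).
split=> // V v k.
under eq_bigr => j _ do rewrite mxE scaler_suml big_mkcond.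
rewrite exchange_big -[LHS]/(\sum_(p <- w' k) p.1 *: v p.2) big_seq.
rewrite [RHS]big_seq; apply: eq_bigr => p pw.
have /tnthP[j pj] : (p.2 : {classic T}) \in in_tuple s.
  rewrite mem_undup; apply: (allpairs_f_dep (fun _ q => q.2 : {classic T})) pw.
  exact: mem_enum.
rewrite (bigD1 j) //= pj eqxx big1 ?addr0 // => j' jj'.
by case: eqP => // /var_inj e; rewrite e eqxx in jj'.
Qed.

(** The equational form of a pure monomorphism; systems without unknowns give injectivity. *)
Definition eq_pure (U V : lmodType R) (f : {linear U -> V}) : Prop :=
  forall m n (A : 'M[R]_(m, n)) (x : 'I_m -> U) (v : 'I_n -> V),
    (forall k, \sum_j A k j *: v j = f (x k)) ->
    exists u : 'I_n -> U, forall k, \sum_j A k j *: u j = x k.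

(** The equational form of a pure epimorphism, see [pure_epiP]: a solution of a finite homogeneous
    system is a map out of a finitely presented module. *)
Definition eq_lift (V W : lmodType R) (g : {linear V -> W}) : Prop :=
  forall m n (A : 'M[R]_(m, n)) (w : 'I_n -> W),
    (forall k, \sum_j A k j *: w j = 0) ->
    exists v : 'I_n -> V,
      (forall k, \sum_j A k j *: v j = 0) /\ forall j, g (v j) = w j.

Lemma extend_injective (I T V : Type) (var : I -> T) (u : I -> V) (v0 : T -> V) :
  injective var -> exists v : T -> V,
    (forall i, v (var i) = u i) /\
    (forall t, (forall i, var i <> t) -> v t = v0 t).
Proof.
move=> var_inj.
exists (fun t => match pselect (exists i, var i = t) with
  | left ex => u (projT1 (cid ex)) | right _ => v0 t end).
split=> [i|t nt]; case: pselect => ex.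
- by rewrite (var_inj _ _ (projT2 (cid ex))).
- by case: ex; exists i.
- by case: ex => i it; case: (nt i it).
- by [].
Qed.

Lemma eq_pure_set (U V : lmodType R) (f : {linear U -> V}) (T : Type)
    (L : set (seq (R * T) * U)) (v : T -> V) :
  eq_pure f -> finite_set L ->
  (forall e, L e -> term_eval v e.1 = f e.2) ->
  exists u : T -> U, forall e, L e -> term_eval u e.1 = e.2.
Proof.
move=> pf /finite_set_index[m [e eL]] vL.
have [n [var [A [var_inj AE]]]] := terms_matrix (fun k => (e k).1).
have [k|u uE] := pf m n A (fun k => (e k).2) (v \o var).
  by rewrite -AE; apply: vL; apply/eL; exists k.
have [u' [u'E _]] := extend_injective u (fun=> 0) var_inj.
exists u' => _ /eL[k <-]; rewrite AE -uE.
by apply: eq_bigr => j _; rewrite u'E.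
Qed.

Lemma eq_lift_surj (V W : lmodType R) (g : {linear V -> W}) :
  eq_lift g -> forall w, exists v, g v = w.
Proof.
(* The system with one unknown and no equation. *)
move=> lg w; have [[]//|v [_ vw]] := lg 0 1 0 (fun=> w).
by exists (v ord0).
Qed.

Lemma eq_lift_set (V W : lmodType R) (g : {linear V -> W}) (T : Type)
    (L : set (seq (R * T))) (w : T -> W) :
  eq_lift g -> finite_set L -> (forall e, L e -> term_eval w e = 0) ->
  exists v : T -> V, (forall e, L e -> term_eval v e = 0) /\ forall t, g (v t) = w t.
Proof.
move=> lg /finite_set_index[m [e eL]] wL.
have [n [var [A [var_inj AE]]]] := terms_matrix e.
have [k|v [vE vw]] := lg m n A (w \o var).
  by rewrite -AE; apply: wL; apply/eL; exists k.
(* Variables outside the system must lift [w] too; surjectivity of [g] provides their values. *)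
have [v0 v0w] := choice (fun t => eq_lift_surj lg (w t)).
have [v' [v'E v'0]] := extend_injective v v0 var_inj.
exists v'; split=> [_ /eL[k <-]|t].
  by rewrite AE -[RHS](vE k); apply: eq_bigr => j _; rewrite v'E.
have [[j <-]|nt] := pselect (exists j, var j = t); first by rewrite v'E vw.
by rewrite v'0 => [|i it]; [exact: v0w|apply: nt; exists i].
Qed.

(** If [v] solves a system with constants in the kernel, then the [g (v j)] solve the homogeneous
    one. Subtracting from [v] a homogeneous lift of them leaves a solution in the kernel. *)
Lemma eq_pure_of_lift (V W : lmodType R) (g : {linear V -> W}) :
  eq_lift g -> eq_pure (ker_incl g).
Proof.
move=> lg m n A x v Avx.
have [k|u [Au gu]] := lg m n A (fun j => g (v j)).
  rewrite -[RHS](kerP (x k)) -[ker_val _]Avx raddf_sum.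
  by apply: eq_bigr => j _; rewrite /= linearZ.
have gvu j : g (v j - u j) == 0 by rewrite raddfB /= gu subrr.
exists (fun j => Ker (gvu j)) => k; apply: val_inj.
rewrite -[LHS]/(ker_incl g _) raddf_sum -[RHS]Avx -[RHS]subr0.
rewrite -[X in _ = _ - X](Au k) -sumrB.
by apply: eq_bigr => j _; rewrite linearZ /= scalerDr.
Qed.

(** An arbitrary lift of [w] satisfies the system up to constants [x] from [U]; by purity these are
    attained in [U], and subtracting that solution corrects the lift. *)
Lemma lift_of_eq_pure (U V W : lmodType R)
    (f : {linear U -> V}) (g : {linear V -> W}) :
  (forall w, exists v, g v = w) -> (forall v, g v = 0 <-> exists u, f u = v) ->
  eq_pure f -> eq_lift g.
Proof.
move=> /choice[s gs] fg pf m n A w Aw.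
have /choice[x fx] k : exists x, f x = \sum_j A k j *: s (w j).
  apply/fg; rewrite raddf_sum -[RHS](Aw k); apply: eq_bigr => j _.
  by rewrite /= linearZ /= gs.
have [u Au] := pf m n A x (s \o w) (fun k => esym (fx k)).
exists (fun j => s (w j) - f (u j)); split=> [k|j].
  under eq_bigr => j _ do rewrite scalerBr.
  rewrite sumrB -fx -Au raddf_sum -sumrB big1 // => j _.
  by rewrite /= linearZ /= subrr.
have /fg gfu : exists x, f x = f (u j) by exists (u j).
by rewrite raddfB /= gs gfu subr0.
Qed.

End LinearSystems.

Lemma eq_pure_at (Q : quiver) (R : pzRingType) (X Y : rep Q R)
    (f : rep_hom X Y) (i : Q) :
  (forall S : rep (op_quiver Q) R^c, injective (rep_tensor_map S f)) ->
  eq_pure (f i).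
Proof.
move=> pf m n A x v Avx.
(* With an empty family of arrows only the matrix equations remain. *)
have [b|u [uA _]] := pure_system pf (al := fun b : void => match b with end)
  (z := fun b => match b with end) (x := x) Avx; [by case: b|by exists u].
Qed.

(** A vertex violating [P] has an arrow to another such vertex; iterating yields an infinite
    path. *)
Lemma right_rooted_ind (Q : quiver) : right_rooted Q ->
  forall P : Q -> Prop,
    (forall i, (forall a : out_arrow i, P (tag a)) -> P i) -> forall i, P i.
Proof.
move=> rQ P IH i; apply: contrapT => nPi.
have next (x : {i | ~ P i}) : {y : {i | ~ P i} & arrow (projT1 x) (projT1 y)}.
  have /existsNP/cid[a nPa] : ~ forall a : out_arrow (projT1 x), P (tag a).
    by move=> H; case: x H => j nPj /= /IH.
  by exists (exist _ (tag a) nPa); exact: (tagged a).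
pose seqv n := iter n (fun x => projT1 (next x)) (exist _ i nPi).
by apply: (rQ (fun n => projT1 (seqv n))) => n; exact: projT2 (next (seqv n)).
Qed.

(** * Pure embeddings over a right rooted quiver *)

Section WellFoundedChoice.
Variables (Q : quiver) (T : Q -> Type) (t0 : forall i, T i).
Variables (ok : forall i, T i -> Prop).
Variables (compat : forall i, T i -> (forall a : out_arrow i, T (tag a)) -> Prop).
Hypothesis rQ : right_rooted Q.
Hypothesis step : forall i (u : forall a : out_arrow i, T (tag a)),
  (forall a, ok (u a)) -> exists t, ok t /\ compat t u.

Let after (j i : Q) : Prop := inhabited (arrow i j).

Let after_wf : well_founded after.
Proof.
apply: (right_rooted_ind rQ) => i IH; constructor => j [a].
exact: (IH (existT _ j a)).
Qed.

(** The default [t0] makes the recursion total; [right_rooted_choice] shows that this branch is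
    never taken. *)
Let F (i : Q) (rec : forall j, after j i -> T j) : T i :=
  match pselect (exists t, ok t /\
      compat t (fun a : out_arrow i => rec (tag a) (inhabits (tagged a)))) with
  | left ex => projT1 (cid ex) | right _ => t0 i end.

Lemma right_rooted_choice : exists t : forall i, T i,
  forall i, ok (t i) /\ compat (t i) (fun a : out_arrow i => t (tag a)).
Proof.
exists (Fix after_wf T F); elim/(right_rooted_ind rQ) => i IH.
rewrite Fix_eq => [|j f g fg]; last first.
  congr F; apply: functional_extensionality_dep => k.
  by apply: functional_extensionality_dep => a; exact: fg.
move: (Fix after_wf T F) IH => t IH.
rewrite /F; case: pselect => [ex|[]]; first exact: projT2 (cid ex).
by apply: step => a; have [] := IH a.
Qed.

End WellFoundedChoice.

Section PureEmbedding.
Variables (Q : quiver) (R : pzRingType) (X Y : rep Q R) (f : rep_hom X Y).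
Hypothesis lQ : locally_target_finite Q.
Hypothesis rQ : right_rooted Q.
Hypothesis f_pure : forall i, eq_pure (f i).
Hypothesis psi_lift : forall i, eq_lift (psi X i).

(* The pair [(w, x)] stands for the linear relation w = f x in Y i.             *)
Let relation (i : Q) := (seq (R * Y i) * X i)%type.
Let relations := set {i : Q & relation i}.

Let valid i (e : relation i) := term_eval id e.1 = f i e.2.

(** Here [u] is a mere function: each instance of linearity, or of being a retraction of [f i], is
    itself a relation to be satisfied. *)
Let holds i (e : relation i) (u : Y i -> X i) := term_eval u e.1 = e.2.

Let push i (a : out_arrow i) (e : relation i) : relation (tag a) :=
  ([seq (q.1, rep_map Y (tagged a) q.2) | q <- e.1], rep_map X (tagged a) e.2).

Let admissible (d : relations) :=
  finite_set d /\ forall t, d t -> valid (tagged t).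

(** The retractions at the targets of the arrows then respect the images of the relations at the
    source, as [local_retraction] requires. *)
Let saturated (d : relations) := forall t (a : out_arrow (tag t)),
  d t -> d (existT _ (tag a) (push a (tagged t))).

Let term_eval_push i (a : out_arrow i) (e : relation i) (V : lmodType R)
    (u : Y (tag a) -> V) :
  term_eval u (push a e).1 =
  term_eval (fun y => u (rep_map Y (tagged a) y)) e.1.
Proof. by rewrite /term_eval big_map. Qed.

Let valid_push i (a : out_arrow i) (e : relation i) : valid e -> valid (push a e).
Proof.
rewrite /valid term_eval_push /= rep_hom_nat => <-.
by rewrite raddf_sum; apply: eq_bigr => q _; rewrite /= linearZ.
Qed.

(** Each vertex has finitely many outgoing arrows and no path is infinite, so the pushes of [e]
    along all paths form a finite set; this is the induction behind it. *)
Let saturate1 i (e : relation i) : valid e ->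
  exists d, [/\ admissible d, saturated d & d (existT _ i e)].
Proof.
elim/(right_rooted_ind rQ): i => i IH in e * => ve.
have /choice[D HD] (a : out_arrow i) := IH a _ (valid_push a ve).
exists ([set existT _ i e] `|` \bigcup_a D a)%classic; split; last by left.
  split=> [|t [->//|[a _ Dat]]]; last first.
    by have [[_ +] _ _] := HD a; apply.
  rewrite finite_setU; split; first exact: finite_set1.
  by apply: bigcup_finite => // a _; have [[]] := HD a.
move=> t a [te|[b _ Dbt]]; right.
  by move: a; rewrite te => a; exists a => //; have [] := HD a.
by exists b => //; have [_ + _] := HD b; apply.
Qed.

Let saturate (d : relations) : admissible d ->
  exists D, [/\ admissible D, saturated D & (d `<=` D)%classic].
Proof.
move=> [fd vd].
have /choice[D HD] (t : {i : Q & relation i}) : exists D, d t ->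
    [/\ admissible D, saturated D & D t].
  have [dt|ndt] := pselect (d t); last by exists set0.
  by have [D HD] := saturate1 (vd t dt); exists D; case: t dt HD.
exists (\bigcup_(t in d) D t)%classic; split.
- split=> [|t [s ds Dst]]; last by have [[_ +] _ _] := HD s ds; apply.
  by apply: bigcup_finite => // t dt; have [[]] := HD t dt.
- by move=> t a [s ds Dst]; exists s => //; have [_ + _] := HD s ds; apply.
- by move=> t dt; exists t => //; have [] := HD t dt.
Qed.

Let relations_at (d : relations) i : set (relation i) :=
  [set e | d (existT _ i e)]%classic.

(** Purity of [f i] gives [v0] satisfying the relations at [i]. Its defect [delta] from
    compatibility with [u] solves the associated homogeneous system, because [d] is saturated.
    Lifting [delta] along psi gives a correction [v1] that keeps the relations and restores
    compatibility. *)
Let local_retraction (d : relations) i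
    (u : forall a : out_arrow i, Y (tag a) -> X (tag a)) :
  admissible d -> saturated d ->
  (forall a e, relations_at d e -> holds e (u a)) ->
  exists v : Y i -> X i, (forall e, relations_at d e -> holds e v) /\
    forall a y, rep_map X (tagged a) (v y) = u a (rep_map Y (tagged a) y).
Proof.
move=> [fd vd] sd ud.
have fdi : finite_set (@relations_at d i).
  apply: (finite_preimage _ fd) => e e' _ _.
  exact: (@eq_from_Tagged {classic Q}).
(* The tautological solution in [Y i]: each element, seen as a variable, has itself as value. *)
have [e de|v0 v0E] := eq_pure_set (v := id) (@f_pure i) fdi.
  exact: (vd (existT _ i e)).
pose delta (y : Y i) : dprod (fun a : out_arrow i => X (tag a)) :=
  fun a => u a (rep_map Y (tagged a) y) - rep_map X (tagged a) (v0 y).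
have [_ [e de <-]|v1 [v1E v1d]] :=
    eq_lift_set (w := delta) (@psi_lift i) (finite_image fst fdi).
  apply: functional_extensionality_dep => a.
  rewrite {1}/term_eval dprod_sumE -[RHS]/0.
  transitivity (term_eval (u a) (push a e).1 -
                rep_map X (tagged a) (term_eval v0 e.1)).
    rewrite term_eval_push raddf_sum -sumrB; apply: eq_bigr => q _.
    by rewrite -[LHS]/(_ *: delta _ a) /= linearZ -scalerBr.
  rewrite (ud a (push a e)) ?(v0E e) ?subrr //.
  exact: (sd (existT _ i e)).
exists (fun y => v0 y + v1 y); split=> [e de|a y].
  have v1e : term_eval v1 e.1 = 0 by apply: v1E; exists e.
  rewrite /holds -[RHS]addr0 -[X in X + _](v0E e) // -[X in _ + X]v1e.
  by rewrite /term_eval -big_split; apply: eq_bigr => q _; rewrite scalerDr.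
have := congr1 (fun w : dprod (fun a : out_arrow i => X (tag a)) => w a) (v1d y).
by rewrite raddfD /= /psi_fun /delta => ->; rewrite addrC subrK.
Qed.

Let retraction (d : relations) : admissible d ->
  exists v : forall i, Y i -> X i,
    (forall i (e : relation i), d (existT _ i e) -> holds e (v i)) /\
    forall i j (a : arrow i j) y, rep_map X a (v i y) = v j (rep_map Y a y).
Proof.
move=> /saturate[D [aD sD dD]].
have [i u uD|v vD] := @right_rooted_choice Q (fun i => Y i -> X i) (fun i _ => 0)
  (fun i v => forall e, @relations_at D i e -> holds e v)
  (fun i v u => forall a y, rep_map X (tagged a) (v y) =
     u a (rep_map Y (tagged a) y)) rQ _.
  exact: local_retraction.
exists v; split=> [i e de|i j a y]; first by apply: (vD i).1; exact: dD.
exact: ((vD i).2 (existT _ j a)).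
Qed.

(** Families vanishing at all sufficiently large admissible sets; the reduced power is the quotient
    by them. *)
Let negligible (S : rep (op_quiver Q) R^c) (phi : relations -> rep_tensor S X) :=
  exists2 d0, admissible d0 &
    forall d, admissible d -> (d0 `<=` d)%classic -> phi d = 0.

Let sg_negligible (S : rep (op_quiver Q) R^c) : subgroup (@negligible S).
Proof.
split=> [|phi phi' [d ad dphi] [d' ad' dphi']].
  by exists set0 => //; split.
exists (d `|` d')%classic => [|D aD].
  split=> [|t []]; first by rewrite finite_setU; split; [case: ad|case: ad'].
    exact: (ad.2).
  exact: (ad'.2).
by rewrite subUset => -[dD d'D]; rewrite -[LHS]/(phi D - phi' D) dphi ?dphi' ?subrr.
Qed.

(* The maps [s (x) y |-> (s (x) v d y)_d], for approximate retractions [v d]   *)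
(* of f, extend the diagonal of S (x) X into a reduced power of S (x) X.       *)
Lemma rep_tensor_map_inj (S : rep (op_quiver Q) R^c) :
  injective (rep_tensor_map S f).
Proof.
have /choice[v vE] (d : relations) : exists v : forall i, Y i -> X i,
    admissible d ->
    (forall i (e : relation i), d (existT _ i e) -> holds e (v i)) /\
    forall i j (a : arrow i j) y, rep_map X a (v i y) = v j (rep_map Y a y).
  have [/retraction[v vd]|nd] := pselect (admissible d); first by exists v.
  by exists (fun i _ => 0).
have sgN := @sg_negligible S.
pose b i (s : S i) (y : Y i) := zq_proj sgN (fun d => rep_tens s (v d i y)).
(* Two classes agree once the families agree at every admissible set containing one suitable
   relation [e]. *)
have near_eq (phi phi' : relations -> rep_tensor S X) i (e : relation i) : valid e ->
    (forall d, admissible d -> holds e (v d i) -> phi d = phi' d) ->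
    zq_proj sgN phi = zq_proj sgN phi'.
  move=> ve H; apply/zq_projP; exists [set existT _ i e]%classic.
    by split=> [|t -> //]; exact: finite_set1.
  move=> d ad ed; apply/eqP; rewrite subr_eq0; apply/eqP/H => //.
  by apply: (vE d ad).1; exact: ed.
have [||||h hE] := @rep_tensor_lift Q R S Y (zquot sgN) b.
- move=> i s y y'; rewrite /b -raddfD.
  (* This relation says that the approximate retraction is additive at [y] and [y']. *)
  apply: (near_eq _ _ i ([:: (1, y + y'); (- 1, y); (- 1, y')], 0)) => [|d _].
    by rewrite /valid /term_eval !big_cons big_nil /= linear0 !scaleN1r scale1r
      addr0 -opprD subrr.
  rewrite /holds /term_eval !big_cons big_nil /= !scaleN1r scale1r addr0 -opprD.
  by move=> /subr0_eq ->; rewrite raddfD.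
- move=> i s s' y; rewrite /b -raddfD; congr zq_proj; apply/funext => d.
  exact: rep_tensDl.
- move=> i r s y.
  apply: (near_eq _ _ i ([:: (1, r *: y); (- r, y)], 0)) => [|d _].
    by rewrite /valid /term_eval !big_cons big_nil /= linear0 scaleNr scale1r
      addr0 subrr.
  rewrite /holds /term_eval !big_cons big_nil /= scaleNr scale1r addr0.
  by move=> /subr0_eq ->; rewrite rep_tensZ.
(* Naturality holds exactly at every admissible set, so the trivial relation suffices. *)
- move=> i j a s y; apply: (near_eq _ _ i ([::], 0)) => [|d ad _].
    by rewrite /valid /term_eval big_nil linear0.
  by rewrite rep_tens_arrow (vE d ad).2.
pose diag (u : rep_tensor S X) := zq_proj sgN (fun _ : relations => u).
have diagB : zmod_morphism diag by move=> u u'; rewrite /diag -raddfB.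
have hdiag u : h (rep_tensor_map S f u) = diag u.
  apply: (@rep_tensor_hom_ext _ _ _ _ _ (h \o rep_tensor_map S f)
    (additive_of diagB) _ u) => i s x.
  rewrite /= rep_tensor_mapE hE.
  (* This relation says that [f i x] is sent back to [x]. *)
  apply: (near_eq _ _ i ([:: (1, f i x)], x)) => [|d _].
    by rewrite /valid /term_eval big_seq1 scale1r.
  by rewrite /holds /term_eval big_seq1 scale1r => ->.
apply: additive_injective => u fu0.
have /zq_proj_eq0[d ad du] : diag u = 0 by rewrite -hdiag fu0 raddf0.
(* The diagonal family is constant, so its value at the single index [d] is [u]. *)
exact: (du d).
Qed.

End PureEmbedding.

(** * Modules as representations of a one-vertex quiver *)

Section PointQuiver.
Variable R : pzRingType.

Definition point_quiver : quiver := @Quiver unit (fun _ _ => void).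

Definition point_rep (A : pzRingType) (V : lmodType A) : rep point_quiver A :=
  @Rep point_quiver A (fun=> V) (fun i j (a : void) => match a with end).

Definition op_point_rep (A : pzRingType) (V : lmodType A) :
    rep (op_quiver point_quiver) A :=
  @Rep (op_quiver point_quiver) A (fun=> V)
    (fun i j (a : void) => match a with end).

Definition point_hom (U V : lmodType R) (f : {linear U -> V}) :
    rep_hom (point_rep U) (point_rep V) :=
  @RepHom point_quiver R (point_rep U) (point_rep V) (fun=> f)
    (fun i j (a : void) => match a with end).

Lemma point_locally_target_finite : locally_target_finite point_quiver.
Proof.
move=> i; rewrite (_ : [set: _] = set0)%classic; first exact: finite_set0.
by rewrite -subset0 => -[j []].
Qed.

Lemma point_right_rooted : right_rooted point_quiver.
Proof. by move=> v /(_ 0). Qed.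

Section Comparison.
Variable S : rep (op_quiver point_quiver) R^c.
Let M : lmodType R^c := S tt.

Lemma point_tensor_iso_balanced (N : lmodType R) :
  mod_balanced (fun p : M * N => @rep_tens _ _ S (point_rep N) tt p.1 p.2).
Proof. by exists (rep_unit_at S (point_rep N) tt). Qed.

Definition point_tensor (N : lmodType R) :
    {additive mod_tensor M N -> rep_tensor S (point_rep N)} :=
  fs_lift (point_tensor_iso_balanced N).

Lemma point_tensorE (N : lmodType R) (m : M) (x : N) :
  point_tensor N (mod_tens m x) = @rep_tens _ _ S (point_rep N) tt m x.
Proof. exact: fs_lift_gen. Qed.

Lemma point_tensor_bij (N : lmodType R) : bijective (point_tensor N).
Proof.
have [||||h hE] := @rep_tensor_lift _ R S (point_rep N) (mod_tensor M N)
  (fun i => match i with tt => fun s x => mod_tens s x end).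
- by move=> [] s; exact: raddfD.
- by move=> [] s s' x; rewrite mod_tensDl.
- by move=> [] r s x; rewrite mod_tensZ.
- by move=> i j [].
exists h => u.
  apply: (fs_hom_ext (h := h \o point_tensor N) (k := idfun) _ u) => -[m x] /=.
  by rewrite -/(mod_tens m x) point_tensorE hE.
apply: (fs_hom_ext (h := point_tensor N \o h) (k := idfun) _ u) => -[[] [s x]] /=.
rewrite -[fs_gen _ _]/(@rep_tens _ _ S (point_rep N) tt s x) hE.
exact: point_tensorE.
Qed.

Lemma point_tensor_nat (U V : lmodType R) (f : {linear U -> V}) u :
  rep_tensor_map S (point_hom f) (point_tensor U u) =
  point_tensor V (mod_tensor_map M f u).
Proof.
apply: (fs_hom_ext (h := rep_tensor_map S (point_hom f) \o point_tensor U)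
  (k := point_tensor V \o mod_tensor_map M f) _ u) => -[m x] /=.
rewrite -/(mod_tens m x) mod_tensor_mapE !point_tensorE.
exact: (@rep_tensor_mapE _ _ S _ _ (point_hom f) tt).
Qed.

Lemma point_tensor_inj (U V : lmodType R) (f : {linear U -> V}) :
  injective (mod_tensor_map M f) <-> injective (rep_tensor_map S (point_hom f)).
Proof.
have [a aK Ka] := point_tensor_bij U; have injV := bij_inj (point_tensor_bij V).
split=> inj u v uv.
  rewrite -[u]Ka -[v]Ka; apply: (congr1 (point_tensor U)).
  by apply/inj/injV; rewrite -!point_tensor_nat !Ka.
apply: (can_inj aK); apply: inj.
by rewrite !point_tensor_nat uv.
Qed.

End Comparison.

Lemma eq_pure_of_mod_tensor (U V : lmodType R) (f : {linear U -> V}) :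
  (forall M : lmodType R^c, injective (mod_tensor_map M f)) -> eq_pure f.
Proof.
move=> inj; apply: (@eq_pure_at _ _ _ _ (point_hom f) tt) => S.
exact/point_tensor_inj/inj.
Qed.

Lemma mod_tensor_map_inj (U V : lmodType R) (f : {linear U -> V})
    (M : lmodType R^c) :
  eq_pure f -> injective (mod_tensor_map M f).
Proof.
move=> pf.
pose S := op_point_rep M.
apply: (point_tensor_inj S f).2; apply: rep_tensor_map_inj => [||i|i].
- exact: point_locally_target_finite.
- exact: point_right_rooted.
- exact: pf.
(* There are no arrows, so the target of psi is the zero module. *)
- move=> m n A w _; exists (fun=> 0); split=> [k|j].
    by rewrite big1 // => j _; rewrite scaler0.
  by apply: functional_extensionality_dep => -[? []].
Qed.

Lemma mod_tensor_short_exact (U V W : lmodType R)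
    (f : {linear U -> V}) (g : {linear V -> W}) (M : lmodType R^c) :
  short_exact f g -> injective (mod_tensor_map M f) ->
  short_exact (mod_tensor_map M f) (mod_tensor_map M g).
Proof.
move=> [_ fg gsurj] inj.
pose S := op_point_rep M.
have injr : injective (rep_tensor_map S (point_hom f)) by exact/point_tensor_inj.
have [_ ex su] := @rep_tensor_short_exact _ _ S _ _ _ (point_hom f) (point_hom g)
   (fun=> gsurj) (fun=> fg) injr.
have [aU aUK KaU] := point_tensor_bij S U; have [aV aVK KaV] := point_tensor_bij S V.
have injV := bij_inj (point_tensor_bij S V).
have injW := bij_inj (point_tensor_bij S W).
split=> // [y|z].
  split=> [gy0|[x <-]].
    have [x xy] : exists x, rep_tensor_map S (point_hom f) x = point_tensor S V y.
      by apply/ex; rewrite point_tensor_nat gy0 raddf0.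
    by exists (aU x); apply: injV; rewrite -point_tensor_nat KaU.
  apply: injW; rewrite raddf0 -2!point_tensor_nat.
  by apply/ex; exists (point_tensor S U x).
have [y yz] := su (point_tensor S W z).
by exists (aV y); apply: injW; rewrite -point_tensor_nat KaV.
Qed.

(** For surjective [g], lifting of homogeneous systems is equational purity of the kernel inclusion,
    which in turn is injectivity of that inclusion after every M (x) -. *)
Lemma pure_epiP (V W : lmodType R) (g : {linear V -> W}) : pure_epi g <-> eq_lift g.
Proof.
split=> [[gsurj [[_ ex _] pg]]|lg].
  apply: (lift_of_eq_pure gsurj ex); apply: eq_pure_of_mod_tensor => M.
  by have [] := pg M.
have ses : short_exact (ker_incl g) g.
  split; [exact: val_inj| |exact: eq_lift_surj].
  move=> y; split=> [gy|[x <-]]; last exact: kerP.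
  by exists (Ker (introT eqP gy)).
split; first exact: eq_lift_surj.
split=> // M; apply: mod_tensor_short_exact => //.
exact/mod_tensor_map_inj/eq_pure_of_lift.
Qed.

End PointQuiver.

Lemma linear_into (R : pzRingType) (U V W : lmodType R)
    (f : {linear U -> V}) (h : {linear W -> V}) :
  injective f -> (forall w, exists u, f u = h w) ->
  exists k : {linear W -> U}, forall w, f (k w) = h w.
Proof.
move=> inj /choice[k kE].
have lin_k : linear k by move=> r x y; apply: inj; rewrite linearP !kE linearP.
by exists (linear_of lin_k).
Qed.

(** * Vanishing of Ext *)

(* Extension along f is required without injectivity of f, for h vanishing on  *)
(* the kernel; this spares the factorization through the image of f.           *)
Definition injective_mod (R : pzRingType) (J : lmodType R) : Prop :=
  forall (U V : lmodType R) (f : {linear U -> V}) (h : {linear U -> J}),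
    (forall x, f x = 0 -> h x = 0) ->
    exists k : {linear V -> J}, forall x, k (f x) = h x.

Section Rows.
Variables (R : pzRingType) (V : lmodType R) (n : nat) (v : 'I_n -> V).

Definition row_map_fun (x : 'rV[R]_n) : V := \sum_j x 0 j *: v j.

Lemma row_map_is_linear : linear row_map_fun.
Proof.
move=> r x y; rewrite /row_map_fun scaler_sumr -big_split.
by apply: eq_bigr => j _; rewrite !mxE scalerDl scalerA.
Qed.
HB.instance Definition _ :=
  GRing.isLinear.Build R 'rV[R]_n V *:%R row_map_fun row_map_is_linear.
Definition row_map : {linear 'rV[R]_n -> V} := row_map_fun.

Lemma row_mapE x : row_map x = \sum_j x 0 j *: v j.
Proof. by []. Qed.

Lemma row_map_delta j : row_map (delta_mx 0 j) = v j.
Proof.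
rewrite row_mapE (bigD1 j) //= mxE !eqxx scale1r big1 ?addr0 // => j' jj'.
by rewrite mxE eqxx (negbTE jj') scale0r.
Qed.
End Rows.

Lemma row_linear_ext (R : pzRingType) (V : lmodType R) n
    (h : {linear 'rV[R]_n -> V}) x :
  h x = \sum_j x 0 j *: h (delta_mx 0 j).
Proof.
by rewrite {1}[x]row_sum_delta raddf_sum; apply: eq_bigr => j _; rewrite /= linearZ.
Qed.

Lemma row_projective (R : pzRingType) n : projective 'rV[R]_n.
Proof.
move=> V W g h gsurj.
have [v gv] := choice (fun j => gsurj (h (delta_mx 0 j))).
exists (row_map v) => x; rewrite row_mapE [RHS]row_linear_ext raddf_sum.
by apply: eq_bigr => j _; rewrite /= linearZ /= gv.
Qed.

Section MatrixModule.
Variables (R : pzRingType) (m n : nat) (A : 'M[R]_(m, n)).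

Lemma mulmxr_is_linear : linear (fun x : 'rV[R]_m => x *m A).
Proof. by move=> r x y; rewrite mulmxDl scalemxAl. Qed.

Definition matrix_map : {linear 'rV[R]_m -> 'rV[R]_n} := linear_of mulmxr_is_linear.

Lemma matrix_mapE x : matrix_map x = x *m A.
Proof. by []. Qed.

Lemma matrix_image_scale (r : R) y :
  (exists x, matrix_map x = y) -> exists x, matrix_map x = r *: y.
Proof. by move=> [x <-]; exists (r *: x); rewrite linearZ. Qed.

Definition matrix_coker : lmodType R :=
  lquot (subgroup_image matrix_map) matrix_image_scale.

Definition matrix_coker_proj : {linear 'rV[R]_n -> matrix_coker} :=
  lq_proj (subgroup_image matrix_map) matrix_image_scale.

Lemma matrix_coker_exact y : matrix_coker_proj y = 0 <-> exists x, matrix_map x = y.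
Proof. exact: lq_proj_eq0. Qed.

Lemma matrix_coker_finitely_presented : finitely_presented matrix_coker.
Proof.
exists m, n, matrix_map, matrix_coker_proj; split; first exact: matrix_coker_exact.
exact: lq_proj_surj.
Qed.

(** Stage [k] is the differential from degree k+1 to degree k. Starting from [matrix_map] makes
    1-cochains tuples of [m] constants, and makes 1-coboundaries those for which the system [A] is
    solvable. *)
Fixpoint matrix_stage k : stage R :=
  if k is l.+1 then next_stage (matrix_stage l) else Stage matrix_map.

Definition matrix_resolution_obj k : lmodType R :=
  if k is l.+1 then stage_src (matrix_stage l) else 'rV[R]_n.

(** Both branches are [stage_map (matrix_stage k)]; the case split lets the codomain reduce to the
    required object. *)
Definition matrix_resolution_d k :
    {linear matrix_resolution_obj k.+1 -> matrix_resolution_obj k} :=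
  match k with
  | 0 => stage_map (matrix_stage 0) | l.+1 => stage_map (matrix_stage l.+1) end.

Lemma matrix_resolution_projective k : projective (matrix_resolution_obj k).
Proof.
by case: k => [|[|k]]; [exact: row_projective..|exact: free_mod_projective].
Qed.

Lemma matrix_resolution_exact k y :
  matrix_resolution_d k y = 0 <-> exists x, matrix_resolution_d k.+1 x = y.
Proof.
case: k y => [|k] y; first exact: (@next_stage_exact _ (matrix_stage 0)).
exact: (@next_stage_exact _ (matrix_stage k.+1)).
Qed.

Definition matrix_resolution : proj_resolution matrix_coker :=
  @ProjResolution R matrix_coker matrix_resolution_obj matrix_resolution_d
    matrix_coker_proj matrix_resolution_projective
    (@lq_proj_surj _ _ _ _ _) matrix_coker_exact
    matrix_resolution_exact.

End MatrixModule.

Section ExtLemmas.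
Variable R : pzRingType.
Implicit Types P L U V W : lmodType R.

(** The constants [x] define a 1-cochain on the resolution of the cokernel of [A]. It is a cocycle
    because its composite with the injective [f] factors through [matrix_map A]; a cochain bounding
    it is a solution in [U]. *)
Lemma eq_pure_of_Ext U V (f : {linear U -> V}) :
  (forall P, finitely_presented P -> Ext_eq0 1 P U) -> injective f -> eq_pure f.
Proof.
move=> extU inj m n A x v Avx.
have fx (r : 'rV[R]_m) : f (row_map x r) = row_map v (matrix_map A r).
  rewrite row_mapE raddf_sum matrix_mapE row_mapE.
  under [RHS]eq_bigr => j _ do rewrite mxE scaler_suml.
  rewrite exchange_big; apply: eq_bigr => k _.
  rewrite /= linearZ /= -Avx scaler_sumr.
  by apply: eq_bigr => j _; rewrite scalerA.
have [y|b bE] := extU _ (matrix_coker_finitely_presented A)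
    (matrix_resolution A) (row_map x).
  apply: inj; rewrite fx raddf0; apply: etrans (raddf0 _); congr (row_map _ _).
  by apply/(matrix_resolution_exact (A := A) (k := 0)); exists y.
exists (fun j => b (delta_mx 0 j)) => k.
rewrite -[RHS](row_map_delta x) bE [RHS]row_linear_ext; apply: eq_bigr => j _.
by rewrite -[pr_d _ _ _]/(delta_mx 0 k *m A) -rowE mxE.
Qed.

(** The images of the generators of P solve the homogeneous system given by the relations of a
    presentation, and a lifted solution defines a map on P. *)
Lemma finitely_presented_lift P V W (g : {linear V -> W}) (h : {linear P -> W}) :
  finitely_presented P -> eq_lift g ->
  exists k : {linear P -> V}, forall x, g (k x) = h x.
Proof.
move=> [m [n [f [p [fp psurj]]]]] lg.
have pf r : p (f r) = 0 by apply/fp; exists r.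
have [k|v [vA gv]] := lg m n (\matrix_(k, j) f (delta_mx 0 k) 0 j)
    (fun j => h (p (delta_mx 0 j))).
  transitivity (h (p (f (delta_mx 0 k)))); last by rewrite pf raddf0.
  rewrite -[RHS]/((h \o p) _) [RHS]row_linear_ext.
  by apply: eq_bigr => j _; rewrite mxE.
have [y /fp[r <-]|k kp] := linear_factor psurj (h := row_map v).
  rewrite -[LHS]/((row_map v \o f) r) row_linear_ext big1 // => k _.
  rewrite -[X in _ *: X = _]/(row_map v (f (delta_mx 0 k))) row_mapE.
  rewrite -[RHS](scaler0 _ (r 0 k)) -[in RHS](vA k); congr (_ *: _).
  by apply: eq_bigr => j _; rewrite mxE.
exists k => x; have [y <-] := psurj x; rewrite kp row_mapE raddf_sum.
rewrite -[RHS]/((h \o p) y) [RHS]row_linear_ext.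
by apply: eq_bigr => j _; rewrite /= linearZ /= gv.
Qed.

Lemma Ext_eq0_iso n P U V (f : {linear U -> V}) :
  injective f -> (forall v, exists u, f u = v) ->
  Ext_eq0 n.+1 P V -> Ext_eq0 n.+1 P U.
Proof.
move=> inj surj extV F c cc.
have [x|b bE] := extV F (f \o c); first by rewrite /= cc raddf0.
have [k kE] := linear_into inj (fun w => surj (b w)).
by exists k => x; apply: inj; rewrite kE -bE.
Qed.

Lemma Ext_eq0_iso_cod n P U V (f : {linear U -> V}) :
  injective f -> (forall v, exists u, f u = v) ->
  Ext_eq0 n.+1 P U -> Ext_eq0 n.+1 P V.
Proof.
move=> inj surj extU F c cc.
have [c' c'E] := linear_into inj (fun w => surj (c w)).
have [x|b bE] := extU F c'; first by apply: inj; rewrite c'E cc raddf0.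
by exists (f \o b) => x; rewrite -c'E bE.
Qed.

Section Shift.
Variables (L E C : lmodType R) (f : {linear L -> E}) (g : {linear E -> C}).
Hypotheses (ses : short_exact f g) (injE : injective_mod E).

Let f_inj : injective f. Proof. by case: ses. Qed.
Let fg y : g y = 0 <-> exists x, f x = y. Proof. by case: ses. Qed.
Let g_surj z : exists y, g y = z. Proof. by case: ses => _ _; apply. Qed.
Let gf x : g (f x) = 0. Proof. by apply/fg; exists x. Qed.

(** Extend the cocycle to [b] with values in E. Then [g \o b] descends to a map from P to C, which
    lifts to E by purity; [b] minus this lift takes values in L and bounds [c]. *)
Lemma Ext1_eq0 P : finitely_presented P -> eq_pure f -> Ext_eq0 1 P L.
Proof.
move=> fpP pf F c cc.
have [x /pr_exact[y <-]|b bE] := injE (f := pr_d F 0) (h := f \o c).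
  by rewrite /= cc raddf0.
have [y /pr_aug_exact[x <-]|h hE] :=
    linear_factor (@pr_aug_surj _ _ F) (h := g \o b).
  by rewrite /= bE /= gf.
have [k kE] := finitely_presented_lift h fpP (lift_of_eq_pure g_surj fg pf).
have [y|b' b'E] := linear_into (h := b \- (k \o pr_aug F)) f_inj.
  by apply/fg; rewrite raddfB /= kE hE /= subrr.
exists b' => x; apply: f_inj; rewrite b'E /= bE /=.
have -> : pr_aug F (pr_d F 0 x) = 0 by apply/pr_aug_exact; exists x.
by rewrite raddf0 subr0.
Qed.

(** Extend [c] to [b] with values in E; [g \o b] is a cocycle, hence bounded by some [b']. A lift of
    [b'] to E corrects [b] to take values in L. *)
Lemma Ext_eq0_sub n P : Ext_eq0 n.+1 P C -> Ext_eq0 n.+2 P L.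
Proof.
move=> extC F c cc.
have [x /pr_exact[y <-]|b bE] := injE (f := pr_d F n.+1) (h := f \o c).
  by rewrite /= cc raddf0.
have [x|b' b'E] := extC F (g \o b); first by rewrite /= bE /= gf.
have [b'' b''E] := @pr_projective _ _ F n _ _ g b' g_surj.
have [y|k kE] := linear_into (h := b \- (b'' \o pr_d F n)) f_inj.
  by apply/fg; rewrite raddfB /= b''E -b'E /= subrr.
exists k => x; apply: f_inj; rewrite kE /= bE /=.
have -> : pr_d F n (pr_d F n.+1 x) = 0 by apply/pr_exact; exists x.
by rewrite raddf0 subr0.
Qed.

(** A lift [c'] of [c] to E has its coboundary in L, where it is bounded by some [b]. The difference
    [c' \- (f \o b)] is a cocycle in E, hence a coboundary, and applying [g] to a bounding cochain
    bounds [c]. *)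
Lemma Ext_eq0_quot n P : Ext_eq0 n.+2 P L -> Ext_eq0 n.+1 P C.
Proof.
move=> extL F c cc.
have dd k x : pr_d F k (pr_d F k.+1 x) = 0 by apply/pr_exact; exists x.
have [c' c'E] := @pr_projective _ _ F n.+1 _ _ g c g_surj.
have [x|k kE] := linear_into (h := c' \o pr_d F n.+1) f_inj.
  by apply/fg; rewrite /= c'E cc.
have [x|b bE] := extL F k; first by apply: f_inj; rewrite kE /= dd !raddf0.
have [x /pr_exact[y <-]|b' b'E] := injE (f := pr_d F n) (h := c' \- (f \o b)).
  by rewrite /= -bE kE /= subrr.
by exists (g \o b') => x; rewrite /= b'E raddfB /= gf subr0 c'E.
Qed.

End Shift.
End ExtLemmas.

(** * Enough injectives *)

Lemma subgroupMz (A : zmodType) (P : A -> Prop) x (z : int) :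
  subgroup P -> P x -> P (x *~ z).
Proof.
move=> sgP Px; have Pn k : P (x *+ k).
  elim: k => [|k IH]; first by rewrite mulr0n; exact: sgP.1.
  by rewrite mulrS; apply: subgroupD.
case: z => k; rewrite ?NegzE ?mulrNz -pmulrn //.
exact: subgroupN.
Qed.

(** The generator is the least positive element, or 0 if there is none. *)
Lemma int_subgroup_principal (I : int -> Prop) : subgroup I ->
  exists n : nat, forall m, I m <-> exists q, m = q * n%:Z.
Proof.
move=> sgI.
have IM (m q : int) : I m -> I (q * m).
  by move=> Im; rewrite mulrC -mulrzz; exact: subgroupMz.
have [exI|nI] := pselect (exists n : nat, `[< I n.+1%:Z >]); last first.
  exists 0%N => m; split=> [Im|[q ->]]; last by rewrite mulr0; exact: sgI.1.
  exists 0; rewrite mulr0; apply: contrapT => /eqP m0; case: nI.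
  case: m Im m0 => [[]|] // k Ik _; exists k; apply/asboolP => //.
  by have := subgroupN sgI Ik; rewrite NegzE opprK.
case: (ex_minnP exI) => n /asboolP In nmin.
exists n.+1 => m; split=> [Im|[q ->]]; last exact: IM.
exists (m %/ n.+1%:Z)%Z; rewrite [LHS](divz_eq m n.+1%:Z).
have Ir : I (m %% n.+1%:Z)%Z.
  by rewrite /modz; apply: sgI.2 => //; apply: IM.
have := @ltz_pmod m n.+1%:Z isT; have : (0 <= m %% n.+1%:Z)%Z%R by exact: modz_ge0.
case: (m %% n.+1%:Z)%Z Ir => // -[|r] Ir _; first by rewrite addr0.
rewrite ltz_nat ltnS => rn; have := nmin r; rewrite leqNgt rn.
by move=> H; case/negP: (H (introT (asboolP _) Ir)).
Qed.

Section GraphExtension.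
Variables (B D : zmodType).
Hypothesis divD : forall (d : D) (n : nat), exists d', d' *+ n.+1 = d.

Implicit Types G : set (B * D).

(** The graph of a homomorphism defined on a subgroup of [B]; for a subgroup, single-valuedness at 0
    is single-valuedness everywhere. *)
Let additive_graph G := subgroup G /\ forall d, G (0, d) -> d = 0.

(* The value at b is chosen by dividing the value at b *~ n, where n generates *)
(* the multiples m such that b *~ m is already in the domain.                  *)
Let graph_adjoin G b : additive_graph G -> exists G',
  [/\ additive_graph G', (G `<=` G')%classic & exists d, G' (b, d)].
Proof.
move=> [sgG fG].
have pairMz (b' : B) (e : D) z : (b', e) *~ z = (b' *~ z, e *~ z).
  by rewrite [LHS]surjective_pairing; congr pair; exact: raddfMz.
have sgI : subgroup (fun m : int => exists e, G (b *~ m, e)).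
  split=> [|m m' [e Ge] [e' Ge']]; first by exists 0; rewrite mulr0z; exact: sgG.1.
  by exists (e - e'); rewrite mulrzBr; exact: (sgG.2 _ _ Ge Ge').
have [n nP] := int_subgroup_principal sgI.
have [e Ge] : exists e, G (b *~ n%:Z, e) by apply/nP; exists 1; rewrite mul1r.
have [d de] : exists d, d *~ n%:Z = e.
  case: n Ge {nP} => [|n] Ge; last by have [d dE] := divD e n; exists d.
  by exists 0; rewrite mulr0z in Ge *; rewrite (fG _ Ge).
exists [set u | exists v m, G v /\ u = v + (b, d) *~ m]%classic; split.
- split=> [|d' [[v1 v2] [m [Gv]]]].
    split=> [|_ _ [v [m [Gv ->]]] [v' [m' [Gv' ->]]]].
      by exists 0, 0; split; [exact: sgG.1|rewrite mulr0z addr0].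
    exists (v - v'), (m - m'); split; first exact: sgG.2.
    by rewrite mulrzBr opprD addrACA.
  rewrite pairMz; move=> [v1E ->].
  have Gm : G (b *~ m, - v2).
    have := subgroupN sgG Gv; congr G; congr pair.
    by apply/eqP; rewrite eq_sym -subr_eq0 opprK addrC -v1E.
  (* As [b *~ m] lies in the old domain, [n] divides [m], and the old value there is [d *~ m]. *)
  have /nP[q mq] : exists e', G (b *~ m, e') by exists (- v2).
  have Gm' : G (b *~ m, d *~ m).
    by rewrite mq mulrC !mulrzA de -pairMz; exact: subgroupMz.
  have := sgG.2 _ _ Gm Gm'; rewrite -[_ - _]/(_ - _, _ - _) subrr => /fG/eqP.
  by rewrite -opprD oppr_eq0 => /eqP.
- by move=> u Gu; exists u, 0; rewrite mulr0z addr0.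
- by exists d, 0, 1; split; [exact: sgG.1|rewrite mulr1z add0r].
Qed.

Lemma additive_graph_extend (G0 : set (B * D)) :
  subgroup G0 -> (forall d, G0 (0, d) -> d = 0) ->
  exists k : {additive B -> D}, forall b d, G0 (b, d) -> k b = d.
Proof.
move=> sg0 f0.
(* The condition is imposed on the union with [G0], so that the empty chain satisfies it. *)
have [F FP totF|G [aG maxG]] :=
    @Zorn_bigcup _ (fun G => additive_graph (G `|` G0)%classic).
  have memU u v : ((\bigcup_(G in F) G) `|` G0)%classic u ->
      ((\bigcup_(G in F) G) `|` G0)%classic v ->
      exists G, [/\ additive_graph (G `|` G0)%classic,
        (G `|` G0)%classic u, (G `|` G0)%classic v &
        (G `<=` \bigcup_(G in F) G)%classic].
    have subF G : F G -> (G `<=` \bigcup_(G in F) G)%classic.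
      by move=> FG w Gw; exists G.
    move=> [[G FG Gu]|Gu] [[G' FG' Gv]|Gv].
    - have [GG'|G'G] := totF _ _ FG FG'.
        by exists G'; split; [exact: FP|left; exact: GG'|left|exact: subF].
      by exists G; split; [exact: FP|left|left; exact: G'G|exact: subF].
    - by exists G; split; [exact: FP|left|right|exact: subF].
    - by exists G'; split; [exact: FP|right|left|exact: subF].
    - by exists set0; rewrite set0U; split.
  split=> [|d H]; last first.
    by have [G [[_ fG] Gd _ _]] := memU _ _ H H; exact: fG.
  split=> [|u v Hu Hv]; first by right; exact: sg0.1.
  have [G [[sgG _] Gu Gv GF]] := memU u v Hu Hv.
  by have [/GF|] := sgG.2 _ _ Gu Gv; [left|right].
set T := (G `|` G0)%classic in aG.
have totT b : exists d, T (b, d).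
  apply: contrapT => nb.
  have [G' [aG' TG' [d G'd]]] := graph_adjoin b aG.
  apply: (maxG G'); last by rewrite (setUidl (subset_trans (@subsetUr _ G G0) TG')).
  split=> [u Gu|G'G]; first by apply: TG'; left.
  by apply: nb; exists d; left; exact: G'G.
have [k kT] := choice totT; have [sgT fT] := aG.
have uniqT b d d' : T (b, d) -> T (b, d') -> d = d'.
  move=> Td Td'; have := sgT.2 _ _ Td Td'; rewrite -[_ - _]/(_ - _, _ - _) subrr.
  by move=> /fT/subr0_eq.
have add_k : zmod_morphism k.
  by move=> x y; apply: (uniqT (x - y)) => //; exact: (sgT.2 _ _ (kT x) (kT y)).
by exists (additive_of add_k) => b d Gd; apply: (uniqT b) => //; right.
Qed.

Lemma additive_extend (A : zmodType) (f : {additive A -> B})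
    (h : {additive A -> D}) :
  (forall x, f x = 0 -> h x = 0) ->
  exists k : {additive B -> D}, forall x, k (f x) = h x.
Proof.
move=> fh; have [||k kE] :=
  @additive_graph_extend [set (f x, h x) | x in setT]%classic.
- split=> [|_ _ [x _ <-] [y _ <-]]; first by exists 0; rewrite ?raddf0.
  by exists (x - y); rewrite ?raddfB.
- by move=> d [x _ [/fh <-]].
by exists k => x; apply: kE; exists x.
Qed.

End GraphExtension.

Lemma int_subgroup_rat : subgroup (fun x : rat => exists z : int, z%:~R = x).
Proof. exact: (subgroup_image (intmul 1 : {additive int -> rat})). Qed.

Definition rat_mod_int : zmodType := zquot int_subgroup_rat.

Lemma rat_mod_int_divisible (d : rat_mod_int) (n : nat) : exists d', d' *+ n.+1 = d.
Proof.
elim/zq_ind: d => x.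
exists (zq_proj int_subgroup_rat (x / n.+1%:R)).
by rewrite -raddfMn -[_ *+ n.+1]mulr_natr divfK // pnatr_eq0.
Qed.

Lemma rat_mod_int_cogenerator (A : zmodType) (u : A) : u != 0 ->
  exists k : {additive A -> rat_mod_int}, k u != 0.
Proof.
move=> u0.
have sgI : subgroup (fun m : int => u *~ m = 0).
  by split=> [|m m' um um']; rewrite ?mulr0z // mulrzBr um um' subrr.
have [n nP] := int_subgroup_principal sgI.
have n1 : n != 1%N.
  apply: contraNneq u0 => n1; rewrite -[u]mulr1z; apply/eqP/nP.
  by exists 1; rewrite n1 mulr1.
(* The element [u] is sent to the class of 1/n'. Here [n'] is the order of [u], or 2 when that order
   is infinite and [n] is 0. *)
have [n' [n'gt1 [q nE]]] : exists n' : nat, (1 < n')%N /\ exists q, n = (n' * q)%N.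
  case: n n1 {nP} => [|[|n]] // _; first by exists 2%N; split=> //; exists 0%N.
  by exists n.+2; split=> //; exists 1%N; rewrite muln1.
have n'0 : n'%:R != 0 :> rat by rewrite pnatr_eq0; case: (n') n'gt1.
pose d : rat_mod_int := zq_proj int_subgroup_rat (n'%:R^-1 : rat).
have dn : d *~ n%:Z = 0.
  have e : (n'%:R^-1 : rat) *+ n' = 1 by rewrite -[LHS]mulr_natr mulVf.
  have d1 : d *+ n' = zq_proj _ 1 by rewrite -[X in zq_proj _ X]e raddfMn.
  rewrite -pmulrn nE mulrnA d1 -raddfMn.
  by apply/zq_proj_eq0; exists q%:Z; rewrite /= -pmulrn.
have d0 : d != 0.
  apply/eqP => /zq_proj_eq0[z]; rewrite /= => zn'.
  have : (z * n'%:Z)%:~R = 1%:~R :> rat.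
    by rewrite intrM zn' -pmulrn mulVf.
  move=> /intr_inj/(congr1 absz); rewrite abszM /= => /eqP.
  by rewrite muln_eq1 => /andP[_ /eqP n'1]; rewrite n'1 in n'gt1.
have [||k kE] := additive_graph_extend rat_mod_int_divisible (B := A)
    (G0 := [set (u *~ m, d *~ m) | m in setT]%classic).
- split=> [|_ _ [m _ <-] [m' _ <-]]; first by exists 0; rewrite ?mulr0z.
  by exists (m - m'); rewrite ?mulrzBr.
- move=> _ [m _ [/nP[p ->] <-]].
  by rewrite mulrC mulrzA dn mul0rz.
exists k; suff -> : k u = d by [].
by apply: kE; exists 1; rewrite ?mulr1z.
Qed.

Section InjectiveHull.
Variable R : pzRingType.

Definition coinduced := homZ R rat_mod_int.
HB.instance Definition _ := GRing.Zmodule.on coinduced.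

Section Scale.
Implicit Types (r : R) (h : coinduced).

Lemma coinduced_scale_is_zmod_morphism r h : zmod_morphism (fun s => h (s * r)).
Proof. by move=> s s'; rewrite mulrBl raddfB. Qed.

Definition coinduced_scale r h : coinduced :=
  additive_of (coinduced_scale_is_zmod_morphism r h).

Lemma coinduced_scaleA a b h :
  coinduced_scale a (coinduced_scale b h) = coinduced_scale (a * b) h.
Proof.
by apply: homZ_ext => s; rewrite /= /additive_of_fun /= /additive_of_fun mulrA.
Qed.
Lemma coinduced_scale1 : left_id 1 coinduced_scale.
Proof. by move=> h; apply: homZ_ext => s; rewrite /= /additive_of_fun mulr1. Qed.
Lemma coinduced_scaleDr : right_distributive coinduced_scale +%R.
Proof. by move=> r h h'; apply: homZ_ext. Qed.
Lemma coinduced_scaleDl h : {morph coinduced_scale^~ h : a b / a + b}.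
Proof.
by move=> a b; apply: homZ_ext => s; rewrite /= /additive_of_fun mulrDr raddfD.
Qed.
HB.instance Definition _ := GRing.Zmodule_isLmodule.Build R coinduced
  coinduced_scaleA coinduced_scale1 coinduced_scaleDr coinduced_scaleDl.
End Scale.

(** Coinduction is right adjoint to the forgetful functor: evaluation at 1 reduces the extension to
    one of additive maps into the divisible group Q/Z. *)
Lemma coinduced_injective : injective_mod coinduced.
Proof.
move=> U V f h fh.
have add1 : zmod_morphism (fun x => (h x : homZ _ _) 1).
  by move=> x y; rewrite raddfB.
have [x /fh hx0|k kE] := additive_extend rat_mod_int_divisible (f := f)
    (h := additive_of add1).
  by rewrite /= /additive_of_fun hx0.
have addk v : zmod_morphism (fun s : R => k (s *: v)).
  by move=> s s'; rewrite scalerBl raddfB.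
pose k' v : coinduced := additive_of (addk v).
have link' : linear k'.
  move=> r x y; apply: homZ_ext => s.
  by rewrite /= /additive_of_fun /= /additive_of_fun scalerDr raddfD scalerA.
exists (linear_of link') => x; apply: homZ_ext => s.
rewrite /= /linear_of_fun /= /additive_of_fun -linearZ kE.
by rewrite /= /additive_of_fun linearZ /= /additive_of_fun mul1r.
Qed.

Lemma dprod_injective (I : Type) (J : I -> lmodType R) :
  (forall i, injective_mod (J i)) -> injective_mod (dprod J).
Proof.
move=> injJ U V f h fh.
have lin_h i : linear (fun x => h x i) by move=> r x y; rewrite linearP.
have ex i : exists k : {linear V -> J i}, forall x, k (f x) = h x i.
  have [x /fh|k kE] := injJ i _ _ f (linear_of (lin_h i)); last by exists k.
  by rewrite /= /linear_of_fun => ->.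
pose k v : dprod J := fun i => projT1 (cid (ex i)) v.
have lin_k : linear k.
  by move=> r x y; apply: functional_extensionality_dep => i; rewrite /k linearP.
exists (linear_of lin_k) => x; apply: functional_extensionality_dep => i.
exact: (projT2 (cid (ex i))).
Qed.

(** One factor for each character of [U]; an injective module containing [U], with no claim of
    minimality. *)
Definition inj_hull (U : lmodType R) : lmodType R :=
  dprod (fun _ : homZ U rat_mod_int => coinduced : lmodType R).

Lemma inj_hull_injective (U : lmodType R) : injective_mod (inj_hull U).
Proof. by apply: dprod_injective => _; exact: coinduced_injective. Qed.

Lemma inj_hull_emb_exists (U : lmodType R) :
  exists f : {linear U -> inj_hull U}, injective f.
Proof.
have addf (phi : homZ U rat_mod_int) u : zmod_morphism (fun s : R => phi (s *: u)).
  by move=> s s'; rewrite scalerBl raddfB.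
pose f u : inj_hull U := fun phi => (additive_of (addf phi u) : homZ _ _).
have lin_f : linear f.
  move=> r x y; apply: functional_extensionality_dep => phi; apply: homZ_ext => s.
  by rewrite /= /additive_of_fun /= /additive_of_fun scalerDr raddfD scalerA.
exists (linear_of lin_f); apply: additive_injective => x fx0.
apply: contrapT => /eqP/rat_mod_int_cogenerator[phi /eqP]; apply.
have := congr1 (fun w : inj_hull U => (w phi : homZ _ _) 1) fx0.
by rewrite /= /linear_of_fun /f /= /additive_of_fun scale1r.
Qed.

Definition inj_hull_emb (U : lmodType R) : {linear U -> inj_hull U} :=
  projT1 (cid (inj_hull_emb_exists U)).

Lemma inj_hull_emb_inj (U : lmodType R) : injective (inj_hull_emb U).
Proof. exact: projT2 (cid (inj_hull_emb_exists U)). Qed.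

End InjectiveHull.

(** * Cofree representations and injective representations *)

Inductive out_path (Q : quiver) (i : Q) : Type :=
  | path_stop
  | path_step (a : out_arrow i) of out_path (tag a).
Arguments path_stop {Q i}.
Arguments path_step {Q i} a p.

Fixpoint path_end (Q : quiver) (i : Q) (p : out_path i) : Q :=
  match p with path_stop => i | path_step _ p => path_end p end.

Section CofreeRep.
Variables (Q : quiver) (R : pzRingType).

Fixpoint path_map (X : rep Q R) (i : Q) (p : out_path i) :
    {linear X i -> X (path_end p)} :=
  match p with
  | path_stop => idfun
  | path_step a p => path_map X p \o rep_map X (tagged a)
  end.

Lemma path_map_nat (X Y : rep Q R) (f : rep_hom X Y) (i : Q) (p : out_path i) x :
  path_map Y p (f i x) = f _ (path_map X p x).
Proof. by elim: p x => [|j a p IH] x //=; rewrite -rep_hom_nat IH. Qed.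

Variable J : Q -> lmodType R.

(** This is the right adjoint to the forgetful functor from representations to families of modules
    indexed by the vertices. *)
Definition cofree_obj (i : Q) : lmodType R :=
  dprod (fun p : out_path i => J (path_end p)).

Definition cofree_map_fun (i : Q) (a : out_arrow i) (w : cofree_obj i) :
    cofree_obj (tag a) :=
  fun p => w (path_step a p).

Lemma cofree_map_is_linear i (a : out_arrow i) : linear (@cofree_map_fun i a).
Proof. by []. Qed.

Definition cofree_rep : rep Q R :=
  @Rep Q R cofree_obj
    (fun i j a => linear_of (@cofree_map_is_linear i (existT _ j a))).

Lemma cofree_path_map i (p : out_path i) (w : cofree_rep i) :
  (path_map cofree_rep p w : cofree_obj _) path_stop = w p.
Proof. by elim: p w => [|j [k a] p IH] w //=; rewrite IH. Qed.

Section Universal.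
Variables (X : rep Q R) (h : forall i, {linear X i -> J i}).

Definition cofree_lift_fun i (x : X i) : cofree_rep i :=
  fun p => h _ (path_map X p x).

Lemma cofree_lift_is_linear i : linear (@cofree_lift_fun i).
Proof.
move=> r x y; apply: functional_extensionality_dep => p.
by rewrite /cofree_lift_fun !linearP.
Qed.

Lemma cofree_lift_nat i j (a : arrow i j) (x : X i) :
  linear_of (@cofree_lift_is_linear j) (rep_map X a x) =
  rep_map cofree_rep a (linear_of (@cofree_lift_is_linear i) x).
Proof. by []. Qed.

Definition cofree_lift : rep_hom X cofree_rep := RepHom cofree_lift_nat.

Lemma cofree_liftE i (x : X i) (p : out_path i) :
  (cofree_lift i x : cofree_obj i) p = h _ (path_map X p x).
Proof. by []. Qed.

End Universal.

(** A morphism into [cofree_rep] is determined by its coordinates at the trivial paths, and these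
    extend independently at each vertex. *)
Lemma cofree_injective : (forall i, injective_mod (J i)) -> injective_rep cofree_rep.
Proof.
move=> injJ X Y f g finj.
have lin_stop i : linear (fun x : X i => (g i x : cofree_obj i) path_stop).
  by move=> r x y; rewrite linearP.
have ex i : exists k : {linear Y i -> J i},
    forall x, k (f i x) = (g i x : cofree_obj i) path_stop.
  have [x fx0|k kE] := injJ i _ _ (f i) (linear_of (lin_stop i)); last by exists k.
  by rewrite (_ : x = 0) ?raddf0 //; apply: (finj i); rewrite fx0 raddf0.
exists (cofree_lift (fun i => projT1 (cid (ex i)))) => i x.
apply: functional_extensionality_dep => p.
rewrite cofree_liftE path_map_nat (projT2 (cid (ex _))) /=.
by rewrite -path_map_nat cofree_path_map.
Qed.

Definition cofree_section_fun i
    (w : dprod (fun a : out_arrow i => cofree_rep (tag a))) : cofree_rep i :=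
  fun p => match p with
  (* The coordinate at the trivial path is invisible to psi; 0 keeps the section linear. *)
  | path_stop => 0 | path_step a p => (w a : cofree_obj (tag a)) p end.

Lemma cofree_section_is_linear i : linear (@cofree_section_fun i).
Proof.
move=> r v w; apply: functional_extensionality_dep => -[|a p] //=.
by rewrite -[RHS]/(r *: (0 : J i) + 0) scaler0 addr0.
Qed.

Definition cofree_section i := linear_of (@cofree_section_is_linear i).

Lemma cofree_sectionK i w : psi cofree_rep i (cofree_section i w) = w.
Proof. by apply: functional_extensionality_dep => -[j a]. Qed.

End CofreeRep.

Section InjectiveRepHull.
Variables (Q : quiver) (R : pzRingType) (X : rep Q R).

Definition rep_hull : rep Q R := cofree_rep (fun i => inj_hull (X i)).

Definition rep_hull_emb : rep_hom X rep_hull :=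
  cofree_lift (fun i => inj_hull_emb (X i)).

Lemma rep_hull_emb_inj i : injective (rep_hull_emb i).
Proof.
move=> x y /(congr1 (fun w : cofree_obj _ i => w path_stop)).
by rewrite !cofree_liftE /=; exact: inj_hull_emb_inj.
Qed.

Lemma rep_hull_injective : injective_rep rep_hull.
Proof. by apply: cofree_injective => i; exact: inj_hull_injective. Qed.

End InjectiveRepHull.

Section InjectiveRep.
Variables (Q : quiver) (R : pzRingType) (E : rep Q R).
Hypothesis injE : injective_rep E.

Let retract : exists r : rep_hom (rep_hull E) E,
  forall i x, r i (rep_hull_emb E i x) = x.
Proof.
have [r rE] := injE (@RepHom _ _ E E (fun i => idfun) (fun _ _ _ _ => erefl))
  (@rep_hull_emb_inj _ _ E).
by exists r.
Qed.

Lemma injective_rep_at i : injective_mod (E i).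
Proof.
have [r rK] := retract; move=> U V f h fh.
have injH : injective_mod (rep_hull E i).
  by apply: dprod_injective => p; exact: inj_hull_injective.
have [x /fh|k kE] := injH _ _ f (rep_hull_emb E i \o h).
  by rewrite /= => ->; rewrite raddf0.
by exists (r i \o k) => x; rewrite /= kE /= rK.
Qed.

(** Embed the tuple in the hull, apply [cofree_section] there, and retract. *)
Lemma injective_rep_section i :
  exists s : {linear dprod (fun a : out_arrow i => E (tag a)) -> E i},
    forall w, psi E i (s w) = w.
Proof.
have [r rK] := retract.
pose m (w : dprod (fun a : out_arrow i => E (tag a))) :
    dprod (fun a : out_arrow i => rep_hull E (tag a)) :=
  fun a => rep_hull_emb E (tag a) (w a).
have lin_m : linear m.
  move=> x v w; apply: functional_extensionality_dep => a.
  exact: (linearP (rep_hull_emb E (tag a))).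
pose s := cofree_section (fun j => inj_hull (E j)) i.
exists (r i \o (s \o linear_of lin_m)) => w.
apply: functional_extensionality_dep => a.
transitivity (r (tag a) (psi (rep_hull E) i (s (m w)) a)).
  exact: esym (rep_hom_nat r (tagged a) _).
rewrite cofree_sectionK; exact: rK.
Qed.

End InjectiveRep.

(** * From pure injective resolutions to vertices *)

Section Forward.
Variables (Q : quiver) (R : pzRingType).

(** The rows of [A] and the prescribed images along all arrows leaving [i] form one finite system,
    solved in [E] by applying the section of psi to the image of [w]. *)
Lemma eq_lift_psi (X E : rep Q R) (f : rep_hom X E) (i : Q) :
  locally_target_finite Q -> injective_rep E ->
  (forall S : rep (op_quiver Q) R^c, injective (rep_tensor_map S f)) ->
  eq_lift (psi X i).
Proof.
move=> lQ injE pf m n A w Aw.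
have [s sK] := injective_rep_section injE i.
pose w' j : dprod (fun a : out_arrow i => E (tag a)) := fun a => f (tag a) (w j a).
have Aw' k : \sum_j A k j *: w' j = 0.
  apply: functional_extensionality_dep => a; rewrite dprod_sumE.
  transitivity (f (tag a) ((\sum_j A k j *: w j) a)); last first.
    by rewrite Aw; exact: raddf0.
  by rewrite dprod_sumE raddf_sum; apply: eq_bigr => j _; rewrite /= linearZ.
have [q [al alP]] := finite_set_index (lQ i).
have [k|b j|u [uA uw]] := pure_system pf (A := A) (al := al) (x := fun=> 0)
    (z := fun b j => w j (al b)) (y := s \o w').
- rewrite raddf0 -[RHS](raddf0 s) -[in RHS](Aw' k) raddf_sum.
  by apply: eq_bigr => j _; rewrite /= linearZ.
- by rewrite -[LHS]/(psi E i (s (w' j)) (al b)) sK.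
exists u; split=> // j; apply: functional_extensionality_dep => a.
have [b <-] : exists b, al b = a by apply/alP.
exact: uw.
Qed.

Section PureResolution.
Variables (X : rep Q R) (E : nat -> rep Q R).
Variable d : forall n, rep_hom (coaugmented X E n) (coaugmented X E n.+1).
Hypothesis injE : forall n, injective_rep (E n).
Hypothesis d_inj : forall i, injective (d 0 i).
Hypothesis dd0 : forall n i x, d n.+1 i (d n i x) = 0.
Hypothesis d_pure : forall n,
  pure_rep_ses (ker_rep_incl (d n)) (ker_rep_lift (@dd0 n)).

(** The map [d 0] is X -> ker (d 1) -> E 0. The first map stays injective by purity at index 0,
    where the kernel is zero, the second by purity at index 1. *)
Lemma coaugmentation_pure (S : rep (op_quiver Q) R^c) :
  injective (rep_tensor_map S (d 0)).
Proof.
have [_ /(_ S)[_ ex0 _]] := d_pure 0; have [_ /(_ S)[inj1 _ _]] := d_pure 1.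
have d0E u : rep_tensor_map S (d 0) u =
    rep_tensor_map S (ker_rep_incl (d 1))
      (rep_tensor_map S (ker_rep_lift (@dd0 0)) u).
  apply: (@rep_tensor_hom_ext _ _ _ _ _ (rep_tensor_map S (d 0))
    (rep_tensor_map S (ker_rep_incl (d 1)) \o
     rep_tensor_map S (ker_rep_lift (@dd0 0)))
    _ u) => i s x.
  rewrite -[RHS]/(rep_tensor_map S (ker_rep_incl (d 1))
    (rep_tensor_map S (ker_rep_lift (@dd0 0)) (rep_tens s x))).
  by rewrite !rep_tensor_mapE.
apply: additive_injective => u; rewrite d0E => u0.
have /ex0[v <-] : rep_tensor_map S (ker_rep_lift (@dd0 0)) u = 0.
  by apply: inj1; rewrite u0 raddf0.
apply: (@rep_tensor_hom_ext _ _ _ _ _ (rep_tensor_map S (ker_rep_incl (d 0)))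
  (\0)%R _ v) => i s x.
rewrite rep_tensor_mapE /= (_ : ker_val x = 0) ?raddf0 //.
by apply: d_inj; rewrite kerP raddf0.
Qed.

(** Purity gives degree 1, and each higher degree shifts to the next kernel. The index starts at
    [n.+1] because term 0 of the coaugmented sequence is X, the later terms being injective. *)
Lemma Ext_ker_eq0 P k n i : finitely_presented P ->
  Ext_eq0 k.+1 P (ker_rep (d n.+1) i).
Proof.
move=> fpP; elim: k n => [|k IH] n.
  apply: (Ext1_eq0 ((d_pure n.+1).1 i) (injective_rep_at (@injE n) (i := i)) fpP).
  by apply: eq_pure_at => S; have [_ /(_ S)[]] := d_pure n.+1.
exact: (Ext_eq0_sub ((d_pure n.+1).1 i) (injective_rep_at (@injE n) (i := i))
  (IH n.+1)).
Qed.

Lemma strongly_fp_injective_coaugmented i : strongly_fp_injective (X i).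
Proof.
move=> P fpP [//|k] _.
have [/(_ i)[_ _ surj] _] := d_pure 0.
(* By exactness X is isomorphic to the kernel of [d 1]. *)
refine (@Ext_eq0_iso R k P (X i) (ker_rep (d 1) i) (ker_rep_lift (@dd0 0) i) _
  surj (@Ext_ker_eq0 P k 0 i fpP)).
by move=> x y /(congr1 (@ker_val _ _ _ _)); exact: d_inj.
Qed.

End PureResolution.

Lemma strongly_fp_injective_rep_at (X : rep Q R) :
  locally_target_finite Q -> strongly_fp_injective_rep X ->
  forall i : Q, strongly_fp_injective (X i) /\ pure_epi (psi X i).
Proof.
move=> lQ [E [d [injE [d_inj _ [dd0 d_pure]]]]] i; split.
  exact: (strongly_fp_injective_coaugmented injE d_inj d_pure).
apply/pure_epiP/(eq_lift_psi lQ (injE 0)) => S.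
exact: (coaugmentation_pure d_inj d_pure).
Qed.

End Forward.

(** * From vertices to pure injective resolutions *)

Section Cokernel.
Variables (Q : quiver) (R : pzRingType) (X Y : rep Q R) (f : rep_hom X Y).

Lemma linear_image_scale i (r : R) (y : Y i) :
  (exists x, f i x = y) -> exists x, f i x = r *: y.
Proof. by move=> [x <-]; exists (r *: x); rewrite linearZ. Qed.

Definition coker_obj i : lmodType R :=
  lquot (subgroup_image (f i)) (@linear_image_scale i).

Definition coker_proj_at i : {linear Y i -> coker_obj i} :=
  lq_proj (subgroup_image (f i)) (@linear_image_scale i).

Lemma coker_proj_exact i y : coker_proj_at i y = 0 <-> exists x, f i x = y.
Proof. exact: lq_proj_eq0. Qed.

Lemma coker_proj_surj i z : exists y, coker_proj_at i y = z.
Proof. exact: lq_proj_surj. Qed.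

Lemma coker_map_exists i j (a : arrow i j) :
  exists k : {linear coker_obj i -> coker_obj j},
    forall y, k (coker_proj_at i y) = coker_proj_at j (rep_map Y a y).
Proof.
have [y /coker_proj_exact[x <-]|k kE] :=
  linear_factor (@coker_proj_surj i) (h := coker_proj_at j \o rep_map Y a).
  by apply/coker_proj_exact; exists (rep_map X a x); rewrite rep_hom_nat.
by exists k.
Qed.

Definition coker_rep : rep Q R :=
  @Rep Q R coker_obj (fun i j a => projT1 (cid (coker_map_exists a))).

Lemma coker_proj_nat i j (a : arrow i j) y :
  coker_proj_at j (rep_map Y a y) = rep_map coker_rep a (coker_proj_at i y).
Proof. exact: esym (projT2 (cid (coker_map_exists a)) y). Qed.

Definition coker_proj : rep_hom Y coker_rep :=
  @RepHom Q R Y coker_rep coker_proj_at coker_proj_nat.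

End Cokernel.

Section ExtAcyclic.
Variables (Q : quiver) (R : pzRingType).

Definition vertexwise_sfp (X : rep Q R) : Prop :=
  (forall i, strongly_fp_injective (X i)) /\ (forall i, eq_lift (psi X i)).

Lemma vertexwise_sfp_zero (X : rep Q R) :
  (forall i (x : X i), x = 0) -> vertexwise_sfp X.
Proof.
move=> X0; split=> i.
  move=> P _ [//|n] _ F c _; exists (\0)%R => x; exact: X0.
move=> m n A w _; exists (fun=> 0); split=> [k|j].
  by rewrite big1 // => j _; rewrite scaler0.
by rewrite raddf0; apply: functional_extensionality_dep => a; rewrite [RHS]X0.
Qed.

Lemma vertexwise_sfp_iso (X Y : rep Q R) (f : rep_hom X Y) :
  (forall i, injective (f i)) -> (forall i y, exists x, f i x = y) ->
  vertexwise_sfp X -> vertexwise_sfp Y.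
Proof.
move=> inj surj [extX liftX]; split=> i.
  by move=> P fpP [//|n] _; apply: (Ext_eq0_iso_cod (inj i) (surj i)); exact: extX.
move=> m n A w Aw.
have ginv j := cid (linear_into (inj j) (h := idfun) (surj j)).
pose g j : {linear Y j -> X j} := projT1 (ginv j).
have fg j y : f j (g j y) = y := projT2 (ginv j) y.
pose w' j : dprod (fun a : out_arrow i => X (tag a)) := fun a => g (tag a) (w j a).
have [k|v [Av vw]] := liftX i m n A w'.
  apply: functional_extensionality_dep => a; rewrite dprod_sumE.
  transitivity (g (tag a) ((\sum_j A k j *: w j) a)).
    by rewrite dprod_sumE raddf_sum; apply: eq_bigr => j _; rewrite /= linearZ.
  by rewrite Aw; exact: raddf0.
exists (fun j => f i (v j)); split=> [k|j].
  rewrite -[RHS](raddf0 (f i)) -[in RHS](Av k) raddf_sum.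
  by apply: eq_bigr => j _; rewrite /= linearZ.
apply: functional_extensionality_dep => a.
rewrite -[LHS]/(rep_map Y (tagged a) (f i (v j))) -rep_hom_nat.
by rewrite -[X in f _ X]/(psi X i (v j) a) vw /w' fg.
Qed.

Lemma vertexwise_sfp_pure (X E : rep Q R) (f : rep_hom X E) i :
  (forall i, injective (f i)) -> vertexwise_sfp X -> eq_pure (f i).
Proof.
by move=> inj [extX _]; apply: eq_pure_of_Ext => // P fpP; exact: extX.
Qed.

(** Ext shifts along the sequence. For psi, each coordinate of [w] lifts to a homogeneous solution
    in E by purity of [f]; the section of psi for E carries these to the vertex [i], and [g i]
    returns them to C. *)
Lemma vertexwise_sfp_quot (X E C : rep Q R) (f : rep_hom X E) (g : rep_hom E C) :
  (forall i, short_exact (f i) (g i)) -> injective_rep E ->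
  vertexwise_sfp X -> vertexwise_sfp C.
Proof.
move=> ses injE sfpX; split=> i.
  move=> P fpP [//|n] _.
  apply: (Ext_eq0_quot (ses i) (injective_rep_at injE (i := i))).
  exact: sfpX.1.
have liftg j : eq_lift (g j).
  have [_ ex surj] := ses j; apply: (lift_of_eq_pure surj ex).
  by apply: vertexwise_sfp_pure => // k; have [] := ses k.
move=> m n A w Aw.
have ex (a : out_arrow i) : exists e : 'I_n -> E (tag a),
    (forall k, \sum_j A k j *: e j = 0) /\ forall j, g (tag a) (e j) = w j a.
  have [k|e eE] := liftg (tag a) m n A (fun j => w j a); last by exists e.
  by have := congr1 (fun u : dprod _ => u a) (Aw k); rewrite dprod_sumE.
pose e j : dprod (fun a : out_arrow i => E (tag a)) :=
  fun a => projT1 (cid (ex a)) j.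
have Ae k : \sum_j A k j *: e j = 0.
  apply: functional_extensionality_dep => a; rewrite dprod_sumE.
  exact: ((projT2 (cid (ex a))).1 k).
have [s sK] := injective_rep_section injE i.
exists (fun j => g i (s (e j))); split=> [k|j].
  rewrite -[RHS](raddf0 (g i \o s)) -[in RHS](Ae k) raddf_sum.
  by apply: eq_bigr => j _; rewrite /= !linearZ.
apply: functional_extensionality_dep => a.
rewrite -[LHS]/(rep_map C (tagged a) (g i (s (e j)))) -rep_hom_nat.
rewrite -[X in g _ X]/(psi E i (s (e j)) a) sK.
exact: ((projT2 (cid (ex a))).2 j).
Qed.

End ExtAcyclic.

Section PureInjectiveResolution.
Variables (Q : quiver) (R : pzRingType) (X : rep Q R).
Hypotheses (lQ : locally_target_finite Q) (rQ : right_rooted Q).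
Hypothesis sfpX : vertexwise_sfp X.

(* The n-th coboundary is [cosyz_proj] followed by the embedding of [cosyz] in  *)
(* its hull, which is the source of the next cosyzygy.                         *)
Record cosyzygy := Cosyzygy {
  cosyz_src : rep Q R; cosyz : rep Q R; cosyz_proj : rep_hom cosyz_src cosyz;
  cosyz_surj : forall i z, exists y, cosyz_proj i y = z;
  cosyz_sfp : vertexwise_sfp cosyz }.

Lemma hull_diff_nat (s : cosyzygy) i j (a : arrow i j) (x : cosyz_src s i) :
  (rep_hull_emb (cosyz s) j \o cosyz_proj s j) (rep_map (cosyz_src s) a x) =
  rep_map (rep_hull (cosyz s)) a ((rep_hull_emb (cosyz s) i \o cosyz_proj s i) x).
Proof. by rewrite /= !rep_hom_nat. Qed.

Definition hull_diff (s : cosyzygy) : rep_hom (cosyz_src s) (rep_hull (cosyz s)) :=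
  @RepHom Q R (cosyz_src s) (rep_hull (cosyz s))
    (fun i => rep_hull_emb (cosyz s) i \o cosyz_proj s i) (@hull_diff_nat s).

Lemma coker_hull_short_exact (C : rep Q R) i :
  short_exact (rep_hull_emb C i) (coker_proj (rep_hull_emb C) i).
Proof.
split; [exact: rep_hull_emb_inj|exact: coker_proj_exact|exact: coker_proj_surj].
Qed.

Definition next_cosyzygy (s : cosyzygy) : cosyzygy :=
  @Cosyzygy _ _ (coker_proj (rep_hull_emb (cosyz s)))
    (@coker_proj_surj _ _ _ _ (rep_hull_emb (cosyz s)))
    (vertexwise_sfp_quot (coker_hull_short_exact (cosyz s))
      (@rep_hull_injective _ _ (cosyz s)) (cosyz_sfp s)).

(** Stage 0 is the identity of X, so that its [hull_diff] is the embedding of X in its hull. *)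
Fixpoint cosyz_stage n : cosyzygy :=
  if n is m.+1 then next_cosyzygy (cosyz_stage m)
  else @Cosyzygy X X (@RepHom _ _ X X (fun i => idfun) (fun _ _ _ _ => erefl))
         (fun i z => ex_intro _ z erefl) sfpX.

Lemma hull_diff_exact (s : cosyzygy) i y :
  hull_diff (next_cosyzygy s) i y = 0 <-> exists x, hull_diff s i x = y.
Proof.
have [inj ex _] := coker_hull_short_exact (cosyz s) i.
transitivity (coker_proj (rep_hull_emb (cosyz s)) i y = 0).
  split=> [|/= ->]; last exact: raddf0.
  rewrite -[X in _ = X -> _](raddf0 (rep_hull_emb (cosyz (next_cosyzygy s)) i)).
  exact: rep_hull_emb_inj.
rewrite ex; split=> [[z <-]|[x <-]]; last by exists (cosyz_proj s i x).
by have [x <-] := @cosyz_surj s i z; exists x.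
Qed.

(** By exactness this kernel is the image of [cosyz s] in its hull, so it is isomorphic to
    [cosyz s]. *)
Lemma vertexwise_sfp_ker (s : cosyzygy) :
  vertexwise_sfp (ker_rep (hull_diff (next_cosyzygy s))).
Proof.
have h0 i (x : cosyz s i) :
    hull_diff (next_cosyzygy s) i (rep_hull_emb (cosyz s) i x) = 0.
  have [y <-] := @cosyz_surj s i x.
  by apply/hull_diff_exact; exists y.
apply: (vertexwise_sfp_iso (f := ker_rep_lift h0)) (cosyz_sfp s) => i.
  by move=> x y /(congr1 (@ker_val _ _ _ _)); exact: rep_hull_emb_inj.
move=> y; have /hull_diff_exact[x xy] := kerP y.
by exists (cosyz_proj s i x); apply: val_inj.
Qed.

Let E n : rep Q R := rep_hull (cosyz (cosyz_stage n)).

Definition hull_resolution_d n :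
    rep_hom (coaugmented X E n) (coaugmented X E n.+1) :=
  match n with
  | 0 => hull_diff (cosyz_stage 0) | m.+1 => hull_diff (cosyz_stage m.+1) end.

Lemma hull_resolution_exact n i y :
  hull_resolution_d n.+1 i y = 0 <-> exists x, hull_resolution_d n i x = y.
Proof. by case: n y => [|n] y; exact: hull_diff_exact. Qed.

Lemma strongly_fp_injective_of_vertexwise_sfp : strongly_fp_injective_rep X.
Proof.
exists E, hull_resolution_d; split=> [n|]; first exact: rep_hull_injective.
have d_inj i : injective (hull_resolution_d 0 i) by exact: rep_hull_emb_inj.
have dd0 n i x : hull_resolution_d n.+1 i (hull_resolution_d n i x) = 0.
  by apply/hull_resolution_exact; exists x.
split=> //; first exact: hull_resolution_exact.
exists dd0 => n.
have ex i (y : coaugmented X E n i) : ker_rep_lift (dd0 n) i y = 0 <->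
    exists x, ker_rep_incl (hull_resolution_d n) i x = y.
  split=> [/(congr1 (@ker_val _ _ _ _)) y0|[x <-]].
    by exists (Ker (introT eqP y0)).
  by apply: val_inj; exact: kerP.
have surj i z : exists y, ker_rep_lift (dd0 n) i y = z.
  have /hull_resolution_exact[y yz] := kerP z.
  by exists y; apply: val_inj.
split=> [i|S]; first by split; [exact: val_inj|exact: ex|exact: surj].
apply: rep_tensor_short_exact => //.
(* For [n] = 0 this kernel is zero; afterwards it is a cosyzygy. *)
have sfpK : vertexwise_sfp (ker_rep (hull_resolution_d n)).
  case: n {ex surj} => [|n]; last exact: vertexwise_sfp_ker.
  apply: vertexwise_sfp_zero => i x; apply: val_inj; apply: (d_inj i).
  by rewrite [LHS]kerP raddf0.
apply: rep_tensor_map_inj => // i; last exact: sfpK.2.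
  by apply: vertexwise_sfp_pure => // j; exact: val_inj.
Qed.

End PureInjectiveResolution.

Theorem theoremB (R : pzRingType) (Q : quiver) (X : rep Q R) :
  locally_target_finite Q ->
  (strongly_fp_injective_rep X ->
     forall i : Q, strongly_fp_injective (X i) /\ pure_epi (psi X i)) /\
  (right_rooted Q ->
     (forall i : Q, strongly_fp_injective (X i) /\ pure_epi (psi X i)) ->
     strongly_fp_injective_rep X).
Proof.
move=> lQ; split=> [|rQ H]; first exact: strongly_fp_injective_rep_at.
apply: strongly_fp_injective_of_vertexwise_sfp => //; split=> i.
  by have [] := H i.
by apply/pure_epiP; have [] := H i.
Qed.
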